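(* Let $M=B^n\times_f\mathbb{F}^m$, with $m>1$, be a connected warped product with warping function $f$ and warped product metric $g$, and let $\varphi,\lambda$ be smooth functions on $B$ such that $(M,g,\nabla\tilde\varphi,\tilde\lambda)$ is a gradient Ricci almost soliton. Let $\mu$ be the constant such that $Ric_{\mathbb{F}}=\mu g_{\mathbb{F}}$. Then $M$ is simply a gradient Ricci soliton Riemannian product (that is, $f$ and $\lambda$ are constant) if either of the following conditions is satisfied: (1) $f$ reaches a minimum on $B$ and $\lambda\geq\frac{\mu}{f^2}$ on $B$ (or $f$ reaches a maximum on $B$ and $\lambda\leq\frac{\mu}{f^2}$ on $B$); (2) $\lambda\leq0$ on $B$ and $\lambda(p)\leq\lambda(q)$, where $p$ and $q$ are maximum and minimum points of $f$ on $B$, respectively.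
   Context: Given Riemannian manifolds $(B^n,g_B)$ and $(\mathbb{F}^m,g_{\mathbb{F}})$ of dimensions $n$ and $m$ and a positive smooth function $f$ on $B$ (the warping function), the warped product $B^n\times_f\mathbb{F}^m$ is $B\times\mathbb{F}$ with the metric $g=\pi^{*}g_{B}+(f\circ\pi)^{2}\sigma^{*}g_{\mathbb{F}}$, where $\pi:B\times\mathbb{F}\to B$ and $\sigma:B\times\mathbb{F}\to\mathbb{F}$ are the projections. For a smooth function $h$ on $B$, $\tilde h=h\circ\pi$ is its lift. The warped product is (up to scaling the fiber metric by a constant) a Riemannian product when $f$ is constant. A complete Riemannian manifold $(M,g)$ is a gradient Ricci almost soliton $(M,g,\nabla\psi,\Lambda)$, where $\psi,\Lambda\in C^\infty(M)$, if $Ric+\nabla^2\psi=\Lambda g$ on $M$, with $Ric$ the Ricci tensor of $g$ and $\nabla^2\psi$ the Hessian of $\psi$. It is a gradient Ricci soliton when $\Lambda$ is constant. In the situation of the claim the fiber is automatically an Einstein manifold: $Ric_{\mathbb{F}}=\mu g_{\mathbb{F}}$, where $Ric_{\mathbb{F}}$ is the Ricci tensor of $(\mathbb{F},g_{\mathbb{F}})$ and $\mu=\lambda f^{2}+f\Delta f+(m-1)|\nabla f|^{2}-f\,g_B(\nabla\varphi,\nabla f)$ is constant, the gradient, Laplacian $\Delta=\mathrm{tr}\,\nabla^2$ and norm being those of $(B,g_B)$. This is the $\mu$ appearing in the conditions. *)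

(* Defs.v *)
From HB Require Import structures.
From mathcomp Require Import all_boot all_order all_algebra.
From mathcomp Require Import all_classical all_reals all_analysis.

Set Implicit Arguments.
Unset Strict Implicit.
Unset Printing Implicit Defensive.

Import Order.TTheory GRing.Theory Num.Theory.
Import numFieldNormedType.Exports.

Local Open Scope ring_scope.
Local Open Scope classical_set_scope.

Definition partial (R : realType) n (i : 'I_n) (u : 'rV[R]_n -> R) :
    'rV[R]_n -> R :=
  fun x => 'D_(delta_mx 0 i) u x.

Fixpoint Ck (R : realType) n (k : nat) (U : set 'rV[R]_n) (u : 'rV[R]_n -> R) :
    Prop :=
  (forall x, U x -> {for x, continuous u}) /\
  if k is k'.+1 then forall i : 'I_n,
    (forall x, U x -> derivable u x (delta_mx 0 i)) /\ Ck k' U (partial i u)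
  else True.

(* Only used for open [U]. *)
Definition smooth_on (R : realType) n (U : set 'rV[R]_n) (u : 'rV[R]_n -> R) :=
  forall k, Ck k U u.

(* A homeomorphism between an open set of [T] and an open set of [R^n]; the
   values of the total functions [cmap] and [cinv] outside of [cdom] and [cimg]
   are irrelevant. *)
Record chart (R : realType) (n : nat) (T : topologicalType) := Chart {
  cdom : set T ;
  cimg : set 'rV[R]_n ;
  cmap : T -> 'rV[R]_n ;
  cinv : 'rV[R]_n -> T ;
  cdom_open : open cdom ;
  cimg_open : open cimg ;
  cmap_img : forall p, cdom p -> cimg (cmap p) ;
  cinv_dom : forall x, cimg x -> cdom (cinv x) ;
  cmapK : forall p, cdom p -> cinv (cmap p) = p ;
  cinvK : forall x, cimg x -> cmap (cinv x) = x ;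
  cmap_continuous : forall p, cdom p -> {for p, continuous cmap} ;
  cinv_continuous : forall x, cimg x -> {for x, continuous cinv} }.

Definition overlap (R : realType) n (T : topologicalType)
    (c d : chart R n T) : set 'rV[R]_n :=
  [set x | cimg c x /\ cdom d (cinv c x)].

Definition transition (R : realType) n (T : topologicalType)
    (c d : chart R n T) : 'rV[R]_n -> 'rV[R]_n :=
  fun x => cmap d (cinv c x).

(* The transposed Jacobian matrix, as vectors are rows. *)
Definition transition_jac (R : realType) n (T : topologicalType)
    (c d : chart R n T) (x : 'rV[R]_n) : 'M[R]_n :=
  \matrix_(a, b) partial a (fun y => transition c d y 0 b) x.

Record manifold (R : realType) (n : nat) := Manifold {
  mspace :> topologicalType ;
  mindex : Type ;
  mchart : mindex -> chart R n mspace ;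
  mspace_hausdorff : hausdorff_space mspace ;
  mspace_second_countable : @second_countable mspace ;
  mspace_nonempty : [set: mspace] !=set0 ;
  mchart_cover : forall p : mspace, exists i, cdom (mchart i) p ;
  mchart_smooth : forall i j k, smooth_on (overlap (mchart i) (mchart j))
    (fun x => transition (mchart i) (mchart j) x 0 k) }.

Definition local_expr (R : realType) n (M : manifold R n) (u : M -> R)
    (i : mindex M) : 'rV[R]_n -> R :=
  fun x => u (cinv (mchart i) x).

Definition smooth_fun (R : realType) n (M : manifold R n) (u : M -> R) :=
  forall i, smooth_on (cimg (mchart i)) (local_expr u i).

(* [metric i x] is the Gram matrix, in the coordinates of the chart [i], of the
   scalar product at the point of coordinates [x]. *)
Record riemannian (R : realType) (n : nat) := Riemannian {
  rmanifold :> manifold R n ;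
  metric : mindex rmanifold -> 'rV[R]_n -> 'M[R]_n ;
  metric_smooth : forall i a b,
    smooth_on (cimg (mchart i)) (fun x => metric i x a b) ;
  metric_sym : forall i x, cimg (mchart i) x -> (metric i x)^T = metric i x ;
  metric_posdef : forall i x, cimg (mchart i) x ->
    forall v : 'rV[R]_n, v != 0 -> 0 < (v *m metric i x *m v^T) 0 0 ;
  metric_transition : forall i j x, overlap (mchart i) (mchart j) x ->
    metric i x =
    transition_jac (mchart i) (mchart j) x
      *m metric j (transition (mchart i) (mchart j) x)
      *m (transition_jac (mchart i) (mchart j) x)^T }.

Section LocalCurvature.
Context (R : realType) (n : nat) (G : 'rV[R]_n -> 'M[R]_n).

(* Gamma^k_{ij} *)
Definition christoffel (k i j : 'I_n) (x : 'rV[R]_n) : R :=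
  2^-1 * \sum_(l < n) invmx (G x) k l *
    (partial i (fun y => G y j l) x + partial j (fun y => G y i l) x
     - partial l (fun y => G y i j) x).

(* The d_l-component of R(d_i, d_j) d_k, where
   R(X, Y) = [nabla_X, nabla_Y] - nabla_[X, Y]. *)
Definition riemann_curvature (l k i j : 'I_n) (x : 'rV[R]_n) : R :=
  partial i (christoffel l j k) x - partial j (christoffel l i k) x
  + \sum_(p < n) (christoffel l i p x * christoffel p j k x
                  - christoffel l j p x * christoffel p i k x).

(* Ric(d_j, d_k) = tr (X |-> R(X, d_j) d_k) *)
Definition local_ricci (x : 'rV[R]_n) : 'M[R]_n :=
  \matrix_(j, k) \sum_(i < n) riemann_curvature i k i j x.

Definition local_hessian (u : 'rV[R]_n -> R) (x : 'rV[R]_n) : 'M[R]_n :=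
  \matrix_(i, j) (partial i (partial j u) x
                  - \sum_(k < n) christoffel k i j x * partial k u x).

End LocalCurvature.

Section RiemannianNotions.
Context (R : realType) (n : nat) (M : riemannian R n).

Definition ricci (i : mindex M) (x : 'rV[R]_n) : 'M[R]_n :=
  local_ricci (metric i) x.

Definition hessian (u : M -> R) (i : mindex M) (x : 'rV[R]_n) : 'M[R]_n :=
  local_hessian (metric i) (local_expr u i) x.

Definition einstein (mu : R) :=
  forall i x, cimg (mchart i) x -> ricci i x = mu *: metric (r := M) i x.

Definition curve_coord (gamma : R -> M) (i : mindex M) (k : 'I_n) : R -> R :=
  fun t => cmap (mchart i) (gamma t) 0 k.

Definition geodesic (gamma : R -> M) :=
  continuous gamma /\
  forall (i : mindex M) (t : R), cdom (mchart i) (gamma t) -> forall k : 'I_n,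
  let c := curve_coord gamma i in
  [/\ derivable (c k) t 1, derivable (derive1 (c k)) t 1 &
      derive1 (derive1 (c k)) t +
      \sum_(a < n) \sum_(b < n)
        christoffel (metric i) k a b (cmap (mchart i) (gamma t))
        * derive1 (c a) t * derive1 (c b) t = 0].

(* Every tangent vector is the initial velocity of a
   geodesic defined on the whole real line. *)
Definition geodesically_complete :=
  forall (i : mindex M) (x v : 'rV[R]_n), cimg (mchart i) x ->
  exists gamma : R -> M, [/\ geodesic gamma, gamma 0 = cinv (mchart i) x &
    forall k, derive1 (curve_coord gamma i k) 0 = v 0 k].

Definition gradient_ricci_almost_soliton (psi Lambda : M -> R) :=
  [/\ geodesically_complete, smooth_fun psi, smooth_fun Lambda &
      forall i x, cimg (mchart i) x ->
        ricci i x + hessian psi i x = local_expr Lambda i x *: metric i x].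

End RiemannianNotions.

Section SmoothLemmas.
Context (R : realType).
Implicit Types n k : nat.

Lemma Ck_cts n k (U : set 'rV[R]_n) u :
  Ck k U u -> forall x, U x -> {for x, continuous u}.
Proof. by case: k => [|k] []. Qed.

Lemma Ck_pred n k (U : set 'rV[R]_n) u : Ck k.+1 U u -> Ck k U u.
Proof.
elim: k u => [|k IHk] u; first by case.
by case=> cu du; split=> // i; have [? ?] := du i; split=> //; exact: IHk.
Qed.

Lemma eq_Ck n k (U : set 'rV[R]_n) u v : open U ->
  (forall x, U x -> u x = v x) -> Ck k U u -> Ck k U v.
Proof.
move=> oU.
have near_uv u' v' : (forall x, U x -> u' x = v' x) ->
    forall x, U x -> \forall y \near x, u' y = v' y :> R.
  by move=> uv x Ux; near=> y; apply: uv; near: y; exact: open_nbhs_nbhs.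
have cts (u' v' : 'rV[R]_n -> R) : (forall x, U x -> u' x = v' x) ->
    (forall x, U x -> {for x, continuous u'}) ->
    forall x, U x -> {for x, continuous v'}.
  move=> uv cu x Ux; rewrite /prop_for /continuous_at -(uv _ Ux).
  apply: cvg_trans (cu x Ux); apply: near_eq_cvg.
    exact: nbhs_filter.
  exact: near_uv Ux.
elim: k u v => [|k IHk] u v uv [cu du]; split=> //; try exact: cts cu.
- move=> i; have [d1 d2] := du i; split.
    move=> x Ux; apply: near_eq_derivable (d1 x Ux); exact: near_uv Ux.
  apply: IHk d2 => x Ux; apply: near_eq_derive; exact: near_uv Ux.
Unshelve. all: by end_near. Qed.

Lemma Ck_add n k (U : set 'rV[R]_n) u v : open U ->
  Ck k U u -> Ck k U v -> Ck k U (fun x => u x + v x).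
Proof.
move=> oU; elim: k u v => [|k IHk] u v [cu du] [cv dv]; split=> //.
- by move=> x Ux; apply: continuousD; [exact: cu | exact: cv].
- by move=> x Ux; apply: continuousD; [exact: cu | exact: cv].
- move=> i; have [d1 d2] := du i; have [e1 e2] := dv i; split.
    by move=> x Ux; apply: derivableD; [exact: d1 | exact: e1].
  apply: (eq_Ck oU) (IHk _ _ d2 e2) => x Ux.
  by rewrite /partial -deriveD; [|exact: d1|exact: e1].
Qed.

Lemma Ck_mul n k (U : set 'rV[R]_n) u v : open U ->
  Ck k U u -> Ck k U v -> Ck k U (fun x => u x * v x).
Proof.
move=> oU; elim: k u v => [|k IHk] u v uC vC;
  have cu := Ck_cts uC; have cv := Ck_cts vC; split=> //.
- by move=> x Ux; apply: continuousM; [exact: cu | exact: cv].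
- by move=> x Ux; apply: continuousM; [exact: cu | exact: cv].
- move=> i; have [d1 d2] := uC.2 i; have [e1 e2] := vC.2 i; split.
    by move=> x Ux; apply: derivableM; [exact: d1 | exact: e1].
  apply: (eq_Ck oU)
    (Ck_add oU (IHk _ _ (Ck_pred uC) e2) (IHk _ _ (Ck_pred vC) d2)) => x Ux.
  by rewrite /partial deriveM; [|exact: d1|exact: e1].
Qed.

Lemma smooth_cst n (U : set 'rV[R]_n) (c : R) : smooth_on U (fun=> c).
Proof.
have cc (d : R) : continuous ((fun=> d) : 'rV[R]_n -> R).
  by move=> x; exact: cst_continuous.
move=> k; elim: k c => [|k IHk] c; split=> //; try by move=> x _; exact: cc.
move=> i; split.
- by move=> x _; exact: derivable_cst.
- have -> : partial i (fun=> c) = fun=> 0 :> R; last exact: IHk.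
  by apply/funext => x; rewrite /partial derive_cst.
Qed.

Lemma smooth_mul n (U : set 'rV[R]_n) u v : open U ->
  smooth_on U u -> smooth_on U v -> smooth_on U (fun x => u x * v x).
Proof. by move=> oU su sv k; apply: Ck_mul. Qed.

Lemma derive_lin n p (L : {linear 'rV[R]_p -> 'rV[R]_n}) (u : 'rV[R]_n -> R)
  x v : 'D_v (u \o L) x = 'D_(L v) u (L x).
Proof.
rewrite /derive; set F := (X in lim (X @ _) = _).
set G := (X in _ = lim (X @ _)); suff -> : F = G by [].
by apply/funext => h; rewrite /F /G /= linearP.
Qed.

Lemma derivable_lin n p (L : {linear 'rV[R]_p -> 'rV[R]_n})
  (u : 'rV[R]_n -> R) x v : derivable u (L x) (L v) -> derivable (u \o L) x v.
Proof.
rewrite /derivable; set F := (X in cvg (X @ _) -> _).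
set G := (X in _ -> cvg (X @ _)); suff -> : G = F by [].
by apply/funext => h; rewrite /F /G /= linearP.
Qed.

(* Composition with a linear map sending each vector of the canonical basis to
   0 or to a vector of the canonical basis, e.g. [lsubmx] and [rsubmx]. *)
Lemma smooth_lin n p (L : {linear 'rV[R]_p -> 'rV[R]_n})
    (U : set 'rV[R]_n) (V : set 'rV[R]_p) u :
  continuous L -> V `<=` L @^-1` U ->
  (forall i, L (delta_mx 0 i) = 0 \/ exists j, L (delta_mx 0 i) = delta_mx 0 j) ->
  smooth_on U u -> smooth_on V (u \o L).
Proof.
move=> cL VU Le su k; have {su} := su k.
elim: k u => [|k IHk] u uC; have cu := Ck_cts uC; split=> //.
- by move=> x /VU Ux; apply: continuous_comp; [exact: cL | exact: cu].
- by move=> x /VU Ux; apply: continuous_comp; [exact: cL | exact: cu].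
- move=> i; have [L0|[j Lj]] := Le i; split.
  + by move=> x _; apply: derivable_lin; rewrite L0; exact: derivable0.
  + have -> : partial i (u \o L) = fun=> 0; last exact: smooth_cst.
    by apply/funext => x; rewrite /partial derive_lin L0 derive0.
  + by move=> x /VU Ux; apply: derivable_lin; rewrite Lj; exact: (uC.2 j).1.
  + have -> : partial i (u \o L) = partial j u \o L.
      by apply/funext => x; rewrite /partial derive_lin Lj.
    by apply: IHk; exact: (uC.2 j).2.
Qed.

Lemma lsubmx_delta n m (i : 'I_(n + m)) :
  lsubmx (delta_mx 0 i : 'rV[R]_(n + m)) =
  if fintype.split i is inl j then delta_mx 0 j else 0.
Proof.
apply/rowP => a; rewrite !mxE; case: splitP => j ij; rewrite !mxE //=.
  by congr (_%:R); rewrite -!val_eqE /= ij.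
by rewrite -val_eqE /= ij (ltn_eqF (ltn_addr _ (ltn_ord a))).
Qed.

Lemma rsubmx_delta n m (i : 'I_(n + m)) :
  rsubmx (delta_mx 0 i : 'rV[R]_(n + m)) =
  if fintype.split i is inr j then delta_mx 0 j else 0.
Proof.
apply/rowP => a; rewrite !mxE; case: splitP => j ij; rewrite !mxE //=.
  by rewrite -val_eqE /= ij gtn_eqF // ltn_addr.
by congr (_%:R); rewrite -!val_eqE /= ij eqn_add2l.
Qed.

Lemma smooth_lsub n m (U : set 'rV[R]_n) (V : set 'rV[R]_(n + m)) u :
  V `<=` lsubmx @^-1` U -> smooth_on U u ->
  smooth_on V (fun x => u (lsubmx x)).
Proof.
move=> VU; apply: (smooth_lin (L := lsubmx)) => //.
- exact: continuous_lsubmx.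
- by move=> i; have := lsubmx_delta i; case: fintype.split => j ?; [right; exists j | left].
Qed.

Lemma smooth_rsub n m (U : set 'rV[R]_m) (V : set 'rV[R]_(n + m)) u :
  V `<=` rsubmx @^-1` U -> smooth_on U u ->
  smooth_on V (fun x => u (rsubmx x)).
Proof.
move=> VU; apply: (smooth_lin (L := rsubmx)) => //.
- exact: continuous_rsubmx.
- by move=> i; have := rsubmx_delta i; case: fintype.split => j ?; [left | right; exists j].
Qed.

Lemma partial_lsub n m i (u : 'rV[R]_n -> R) (x : 'rV[R]_(n + m)) :
  partial i (fun y => u (lsubmx y)) x =
  if fintype.split i is inl j then partial j u (lsubmx x) else 0.
Proof.
transitivity ('D_(lsubmx (delta_mx 0 i : 'rV[R]_(n + m))) u (lsubmx x)).
  exact: (derive_lin (lsubmx : {linear 'rV[R]_(n + m) -> _})).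
rewrite lsubmx_delta.
by case: fintype.split => // j; rewrite derive0.
Qed.

Lemma partial_rsub n m i (u : 'rV[R]_m -> R) (x : 'rV[R]_(n + m)) :
  partial i (fun y => u (rsubmx y)) x =
  if fintype.split i is inr j then partial j u (rsubmx x) else 0.
Proof.
transitivity ('D_(rsubmx (delta_mx 0 i : 'rV[R]_(n + m))) u (rsubmx x)).
  exact: (derive_lin (rsubmx : {linear 'rV[R]_(n + m) -> _})).
rewrite rsubmx_delta.
by case: fintype.split => // j; rewrite derive0.
Qed.

End SmoothLemmas.

Section ProductTopology.
Context (S T : topologicalType).

Lemma prod_hausdorff : hausdorff_space S -> hausdorff_space T ->
  hausdorff_space (S * T)%type.
Proof.
move=> hS hT [a b] [c d] cl; congr pair.
- apply: hS => A B nA nB.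
  have nA' : nbhs (a, b) (fst @^-1` A) by exact: (@cvg_fst _ _ (nbhs a)).
  have nB' : nbhs (c, d) (fst @^-1` B) by exact: (@cvg_fst _ _ (nbhs c)).
  by have [[x y] [? ?]] := cl _ _ nA' nB'; exists x.
- apply: hT => A B nA nB.
  have nA' : nbhs (a, b) (snd @^-1` A) by exact: (@cvg_snd _ _ _ (nbhs b)).
  have nB' : nbhs (c, d) (snd @^-1` B) by exact: (@cvg_snd _ _ _ (nbhs d)).
  by have [[x y] [? ?]] := cl _ _ nA' nB'; exists y.
Qed.

Lemma open_setX (A : set S) (B : set T) : open A -> open B -> open (A `*` B).
Proof.
move=> oA oB; rewrite openE => -[x y] [/= Ax By].
by exists (A, B) => //; split; exact: open_nbhs_nbhs.
Qed.

Lemma prod_second_countable : @second_countable S -> @second_countable T ->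
  @second_countable (S * T)%type.
Proof.
move=> [P cP [oP bP]] [Q cQ [oQ bQ]].
exists [set W.1 `*` W.2 | W in P `*` Q].
  apply: (card_le_trans (card_image_le _ _)); exact: countableX.
split=> [_ [[U V] [/= PU QV] <-]|[x y] A [[A1 A2] [/= nx ny] AA]].
  by apply: open_setX; [exact: oP | exact: oQ].
have [U [PU Ux] UA] := bP x _ nx; have [V [QV Vy] VA] := bQ y _ ny.
exists (U `*` V); first by split=> //; exists (U, V).
by move=> [u v] [/= ? ?]; apply: AA; split; [exact: UA | exact: VA].
Qed.

End ProductTopology.

Section ProductChart.
Context (R : realType) (n m : nat) (S T : topologicalType).

Section OneChart.
Context (c : chart R n S) (d : chart R m T).

Definition prod_cdom : set (S * T) := cdom c `*` cdom d.
Definition prod_cimg : set 'rV[R]_(n + m) :=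
  [set x | cimg c (lsubmx x) /\ cimg d (rsubmx x)].
Definition prod_cmap (p : S * T) : 'rV[R]_(n + m) :=
  row_mx (cmap c p.1) (cmap d p.2).
Definition prod_cinv (x : 'rV[R]_(n + m)) : S * T :=
  (cinv c (lsubmx x), cinv d (rsubmx x)).

Lemma prod_cimg_open : open prod_cimg.
Proof.
have oc : open ((lsubmx : 'rV[R]_(n + m) -> _) @^-1` cimg c).
  by apply: open_comp; [move=> x _; exact: continuous_lsubmx | exact: cimg_open].
have od : open ((rsubmx : 'rV[R]_(n + m) -> _) @^-1` cimg d).
  by apply: open_comp; [move=> x _; exact: continuous_rsubmx | exact: cimg_open].
exact: openI oc od.
Qed.

Lemma prod_cmap_img p : prod_cdom p -> prod_cimg (prod_cmap p).
Proof.
by move=> [? ?]; split; rewrite ?row_mxKl ?row_mxKr; exact: cmap_img.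
Qed.

Lemma prod_cinv_dom x : prod_cimg x -> prod_cdom (prod_cinv x).
Proof. by move=> [? ?]; split; exact: cinv_dom. Qed.

Lemma prod_cmapK p : prod_cdom p -> prod_cinv (prod_cmap p) = p.
Proof.
by case: p => p q [? ?]; rewrite /prod_cinv row_mxKl row_mxKr !cmapK.
Qed.

Lemma prod_cinvK x : prod_cimg x -> prod_cmap (prod_cinv x) = x.
Proof. by move=> [? ?]; rewrite /prod_cmap !cinvK // hsubmxK. Qed.

Lemma prod_cmap_continuous p : prod_cdom p -> {for p, continuous prod_cmap}.
Proof.
case: p => p q [/= cp dq] A /nbhs_ballP[e e0 eA].
have nc := cmap_continuous cp (nbhsx_ballx _ _ e0).
have nd := cmap_continuous dq (nbhsx_ballx _ _ e0).
exists (cmap c @^-1` ball (cmap c p) e, cmap d @^-1` ball (cmap d q) e) => //.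
move=> [u v] [/= [_ cu] [_ dv]]; apply: eA; split=> // i j; rewrite !mxE /=.
by case: fintype.split.
Qed.

Lemma prod_cinv_continuous x : prod_cimg x -> {for x, continuous prod_cinv}.
Proof.
move=> [cx dx]; apply: (@cvg_pair _ _ _ (nbhs x) (nbhs _) (nbhs _)).
- have c_ : {for x, continuous (lsubmx : 'rV[R]_(n + m) -> 'rV[R]_n)}.
    exact: continuous_lsubmx.
  exact: (continuous_comp c_ (cinv_continuous cx)).
- have d_ : {for x, continuous (rsubmx : 'rV[R]_(n + m) -> 'rV[R]_m)}.
    exact: continuous_rsubmx.
  exact: (continuous_comp d_ (cinv_continuous dx)).
Qed.

Definition prod_chart : chart R (n + m) (S * T)%type :=
  Chart (open_setX (cdom_open c) (cdom_open d)) prod_cimg_open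
    prod_cmap_img prod_cinv_dom prod_cmapK prod_cinvK
    prod_cmap_continuous prod_cinv_continuous.

End OneChart.

Context (c c' : chart R n S) (d d' : chart R m T).

Lemma transition_prod x b :
  transition (prod_chart c d) (prod_chart c' d') x 0 b =
  match fintype.split b with
  | inl j => transition c c' (lsubmx x) 0 j
  | inr j => transition d d' (rsubmx x) 0 j
  end.
Proof. by rewrite [LHS]mxE /=; case: fintype.split. Qed.

Lemma transition_jac_prod x :
  transition_jac (prod_chart c d) (prod_chart c' d') x =
  block_mx (transition_jac c c' (lsubmx x)) 0
           0 (transition_jac d d' (rsubmx x)).
Proof.
apply/matrixP => a b; rewrite [LHS]mxE (funext (transition_prod ^~ b)) mxE.
case Eb: (fintype.split b) => [j|j].
- rewrite (partial_lsub a (fun y => transition c c' y 0 j)).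
  by case: (fintype.split a) => i; rewrite mxE Eb !mxE.
- rewrite (partial_rsub a (fun y => transition d d' y 0 j)).
  by case: (fintype.split a) => i; rewrite mxE Eb !mxE.
Qed.

Lemma overlap_prod x :
  overlap (prod_chart c d) (prod_chart c' d') x ->
  overlap c c' (lsubmx x) /\ overlap d d' (rsubmx x).
Proof. by move=> [[? ?] [? ?]]. Qed.

End ProductChart.

Section WarpedProduct.
Context (R : realType) (n m : nat).

Section ProductManifold.
Context (B : manifold R n) (F : manifold R m).

Definition prod_mchart (ij : mindex B * mindex F) :
    chart R (n + m) (B * F)%type :=
  prod_chart (mchart ij.1) (mchart ij.2).

Lemma prod_nonempty : [set: B * F] !=set0.
Proof.
have [b _] := mspace_nonempty B; have [q _] := mspace_nonempty F.
by exists (b, q).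
Qed.

Lemma prod_mchart_cover (p : B * F) : exists ij, cdom (prod_mchart ij) p.
Proof.
have [i ?] := mchart_cover p.1; have [j ?] := mchart_cover p.2.
by exists (i, j).
Qed.

Lemma prod_mchart_smooth i j k :
  smooth_on (overlap (prod_mchart i) (prod_mchart j))
    (fun x => transition (prod_mchart i) (prod_mchart j) x 0 k).
Proof.
rewrite (funext (transition_prod _ _ _ _ ^~ k)).
case: (fintype.split k) => l.
- apply: (smooth_lsub (u := fun y => transition _ _ y 0 l) _
    (mchart_smooth i.1 j.1 l)) => x /overlap_prod[]; exact.
- apply: (smooth_rsub (u := fun y => transition _ _ y 0 l) _
    (mchart_smooth i.2 j.2 l)) => x /overlap_prod[]; exact.
Qed.

Definition prod_manifold : manifold R (n + m) :=
  @Manifold R (n + m) (B * F)%type (mindex B * mindex F)%type prod_mchart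
    (prod_hausdorff (@mspace_hausdorff _ _ B) (@mspace_hausdorff _ _ F))
    (prod_second_countable (@mspace_second_countable _ _ B)
                           (@mspace_second_countable _ _ F))
    prod_nonempty prod_mchart_cover prod_mchart_smooth.

End ProductManifold.

Context (B : riemannian R n) (F : riemannian R m) (f : B -> R).
Context (f_smooth : smooth_fun f) (f_gt0 : forall x, 0 < f x).

(* pi^* g_B + (f o pi)^2 sigma^* g_F, read in product charts. *)
Definition warped_metric (ij : mindex (prod_manifold B F))
    (x : 'rV[R]_(n + m)) : 'M[R]_(n + m) :=
  block_mx (metric ij.1 (lsubmx x)) 0
           0 (local_expr f ij.1 (lsubmx x) ^+ 2 *: metric ij.2 (rsubmx x)).

Lemma warped_metric_smooth ij a b :
  smooth_on (cimg (mchart ij)) (fun x => warped_metric ij x a b).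
Proof.
pose g x := match fintype.split a, fintype.split b with
  | inl i, inl j => metric ij.1 (lsubmx x) i j
  | inr i, inr j => (local_expr f ij.1 (lsubmx x) *
      local_expr f ij.1 (lsubmx x)) * metric ij.2 (rsubmx x) i j
  | _, _ => 0
  end.
have -> : (fun x => warped_metric ij x a b) = g.
  apply/funext => x; rewrite /g mxE; case: fintype.split => i; rewrite mxE;
    by case: fintype.split => j; rewrite ?mxE.
have oU : open (cimg (mchart ij)) by exact: cimg_open.
have lU : cimg (mchart ij) `<=` lsubmx @^-1` cimg (mchart ij.1).
  by move=> x [].
have rU : cimg (mchart ij) `<=` rsubmx @^-1` cimg (mchart ij.2).
  by move=> x [].
rewrite /g; case: fintype.split => i; case: fintype.split => j.
- exact: (smooth_lsub lU (metric_smooth (r := B) ij.1 i j)).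
- exact: smooth_cst.
- exact: smooth_cst.
- have sf := smooth_lsub lU (f_smooth ij.1).
  apply: smooth_mul => //; first exact: smooth_mul.
  exact: (smooth_rsub rU (metric_smooth (r := F) ij.2 i j)).
Qed.

Lemma warped_metric_sym ij x : cimg (mchart ij) x ->
  (warped_metric ij x)^T = warped_metric ij x.
Proof.
move=> [Bx Fx]; rewrite /warped_metric tr_block_mx !trmx0 linearZ /=.
by rewrite !metric_sym.
Qed.

Lemma warped_metric_posdef ij x : cimg (mchart ij) x ->
  forall v : 'rV[R]_(n + m), v != 0 ->
  0 < (v *m warped_metric ij x *m v^T) 0 0.
Proof.
move=> [Bx Fx] v; rewrite -[v]hsubmxK; set a := lsubmx v; set b := rsubmx v.
move=> ab0; rewrite /warped_metric mul_row_block !mulmx0 add0r addr0.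
rewrite tr_row_mx mul_row_col -scalemxAr -scalemxAl.
rewrite [ltRHS]mxE [X in _ + X]mxE.
set s := local_expr f _ _; have s0 : 0 < s ^+ 2 by rewrite exprn_gt0 // f_gt0.
have pa := metric_posdef Bx (v := a); have pb := metric_posdef Fx (v := b).
have [a0|/pa{}pa] := eqVneq a 0; have [b0|/pb{}pb] := eqVneq b 0.
- by rewrite a0 b0 row_mx0 eqxx in ab0.
- by rewrite a0 !mul0mx [X in X + _]mxE add0r mulr_gt0.
- by rewrite b0 !mul0mx [X in _ * X]mxE mulr0 addr0.
- by rewrite addr_gt0 // mulr_gt0.
Qed.

Lemma warped_metric_transition i j x : overlap (mchart i) (mchart j) x ->
  warped_metric i x =
  transition_jac (mchart i) (mchart j) x
    *m warped_metric j (transition (mchart i) (mchart j) x)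
    *m (transition_jac (mchart i) (mchart j) x)^T.
Proof.
move=> /overlap_prod[oB oF]; rewrite transition_jac_prod /warped_metric.
rewrite row_mxKl row_mxKr tr_block_mx !trmx0 !mulmx_block.
rewrite !(mulmx0, mul0mx, addr0, add0r) -scalemxAr -scalemxAl.
rewrite -(metric_transition oB) -(metric_transition oF).
by rewrite /local_expr cmapK //; case: oB.
Qed.

Definition warped_product : riemannian R (n + m) :=
  @Riemannian R (n + m) (prod_manifold B F) warped_metric
    warped_metric_smooth warped_metric_sym warped_metric_posdef
    warped_metric_transition.

End WarpedProduct.

(* Main.v *)
Require Import Defs.
From mathcomp Require Import all_boot all_order all_algebra.
From mathcomp Require Import all_classical all_reals all_analysis.
From mathcomp Require Import ring lra.

(** Only the component of the soliton equation in a fibre direction matters.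
    In a product chart, with [h] the metric of the fibre, the Ricci tensor of
    the warped product is [Ric_F - (f Delta f + (m - 1) |df|^2) h] on two fibre
    vectors, and the Hessian of the lift of [phi] is [f <dphi, df> h] there.
    With [Ric_F = mu h], comparing the coefficients of [h] gives
    [[
      f Delta f + (m - 1) |df|^2 - f <dphi, df> = mu - lambda f^2,
    ]]
    that is, [E f = (mu - lambda f^2) / f], where
    [E u = Delta u + <((m - 1) / f) df - dphi, du>] is a linear elliptic
    operator without zeroth order term, the first factor [df] being absorbed
    into the coefficients ([fibre_equation], [warping_equation]).

    If [lambda <= mu / f^2] then [f] is a subsolution of [E], and it is constant
    as soon as it has a maximum, by the strong maximum principle on the
    connected base ([constant_of_max]); if [lambda >= mu / f^2] and [f] has a
    minimum, the same applies to [- f]. In the last case of the theorem,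
    evaluating the equation at the maximum [p] and at the minimum [q] gives
    [lambda q * f q ^+ 2 <= mu <= lambda p * f p ^+ 2], while the signs give
    the reverse inequality; so either [f p = f q], or
    [mu = lambda p = lambda q = 0] and [lambda <= 0 = mu / f^2], which is the
    case of a maximum. Once [f] is constant, the equation reads
    [lambda = mu / f^2].

    The strong maximum principle is local and is proved in charts by the
    method of Hopf. If [u <= M] satisfies [E u >= 0] and the set [u = M] is not
    open, there is a ball meeting this set at a single point [z] of its
    boundary ([strong_maximum]). A barrier [v] with [v z = 0], [E v > 0] near
    [z] and [v < 0] outside of the ball ([barrier]) makes [u + e v] have an
    interior maximum where [E (u + e v) > 0] ([hopf_touching]), whereas
    [E <= 0] at such a point ([elliptic_max]). *)

Set Implicit Arguments.
Unset Strict Implicit.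
Unset Printing Implicit Defensive.

Import Order.TTheory GRing.Theory Num.Theory.
Import numFieldNormedType.Exports.

Local Open Scope ring_scope.
Local Open Scope classical_set_scope.

(** * Calculus of smooth functions on an open set *)

Section SmoothCalculus.
Context (R : realType) (n : nat) (U : set 'rV[R]_n) (oU : open U).
Implicit Types (u v : 'rV[R]_n -> R) (x : 'rV[R]_n).

Lemma near_open x : U x -> \forall y \near x, U y.
Proof. by move=> Ux; apply: open_nbhs_nbhs. Qed.

Lemma smooth_continuous u x : smooth_on U u -> U x -> {for x, continuous u}.
Proof. by move=> su; exact: (su 0).1. Qed.

Lemma smooth_derivable u x i :
  smooth_on U u -> U x -> derivable u x (delta_mx 0 i).
Proof. by move=> su; exact: ((su 1).2 i).1. Qed.

Lemma smooth_partial u i : smooth_on U u -> smooth_on U (partial i u).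
Proof. by move=> su k; exact: ((su k.+1).2 i).2. Qed.

Lemma eq_smooth u v : (forall x, U x -> u x = v x) ->
  smooth_on U u -> smooth_on U v.
Proof. by move=> uv su k; exact: eq_Ck (su k). Qed.

Lemma eq_partial u v i x : (forall x, U x -> u x = v x) -> U x ->
  partial i u x = partial i v x.
Proof.
move=> uv Ux; apply: near_eq_derive; near=> y; apply: uv; near: y.
exact: near_open.
Unshelve. all: by end_near. Qed.

Lemma smooth_add u v : smooth_on U u -> smooth_on U v ->
  smooth_on U (fun x => u x + v x).
Proof. by move=> su sv k; exact: Ck_add. Qed.

Lemma smooth_opp u : smooth_on U u -> smooth_on U (fun x => - u x).
Proof.
move=> su; apply: (@eq_smooth (fun x => (-1) * u x)).
  by move=> x _; rewrite mulN1r.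
by apply: smooth_mul => //; exact: smooth_cst.
Qed.

Lemma smooth_sum (I : Type) (r : seq I) (P : pred I)
    (u : I -> 'rV[R]_n -> R) :
  (forall i, P i -> smooth_on U (u i)) ->
  smooth_on U (fun x => \sum_(i <- r | P i) u i x).
Proof.
move=> su; elim: r => [|i r IHr].
  apply: (@eq_smooth (fun=> 0)); last exact: smooth_cst.
  by move=> x _; rewrite big_nil.
apply: (@eq_smooth (fun x => (if P i then u i x else 0) +
    \sum_(i <- r | P i) u i x)).
  by move=> x _; rewrite big_cons; case: ifP => //; rewrite add0r.
apply: smooth_add => //; case Pi: (P i); [exact: su | exact: smooth_cst].
Qed.

Lemma smooth_prod (I : Type) (r : seq I) (u : I -> 'rV[R]_n -> R) :
  (forall i, smooth_on U (u i)) -> smooth_on U (fun x => \prod_(i <- r) u i x).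
Proof.
move=> su; elim: r => [|i r IHr].
  apply: (@eq_smooth (fun=> 1)); last exact: smooth_cst.
  by move=> x _; rewrite big_nil.
apply: (@eq_smooth (fun x => u i x * \prod_(i <- r) u i x)).
  by move=> x _; rewrite big_cons.
exact: smooth_mul.
Qed.

(** Each partial derivative of the inverse is a product of smooth functions and
    two inverses, so smoothness follows by induction on the order. *)
Lemma smooth_inv u : (forall x, U x -> u x != 0) -> smooth_on U u ->
  smooth_on U (fun x => (u x)^-1).
Proof.
move=> u0 su; elim=> [|k IHk];
  have cVu x : U x -> {for x, continuous (fun x => (u x)^-1)}.
- by move=> Ux; apply: continuousV; [exact: u0 | exact: smooth_continuous].
- by split.
- by move=> Ux; apply: continuousV; [exact: u0 | exact: smooth_continuous].
split=> // i; split.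
  by move=> x Ux; apply: derivableV; [exact: u0 | exact: smooth_derivable].
apply: (@eq_Ck _ _ _ _
  (fun x => (-1) * ((u x)^-1 * (u x)^-1) * partial i u x)) => //.
  move=> x Ux; rewrite /partial deriveV ?u0 //; last exact: smooth_derivable.
  by rewrite /GRing.scale /= mulN1r -invfM expr2.
apply: Ck_mul => //; last exact: (smooth_partial i su).
apply: Ck_mul => //; first exact: (@smooth_cst _ _ U (-1) k).
exact: Ck_mul.
Qed.

Lemma partial_coord i k :
  partial i (fun x : 'rV[R]_n => x 0 k) = fun=> (i == k)%:R.
Proof.
apply/funext => x.
have := derive_mx (@derivable_id R 'rV[R]_n x (delta_mx 0 i)).
by rewrite derive_id => /matrixP/(_ 0 k); rewrite !mxE /= eq_sym /partial => ->.
Qed.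

Lemma smooth_coord (k : 'I_n) : smooth_on U (fun x : 'rV[R]_n => x 0 k).
Proof.
have ck x : {for x, continuous (fun x : 'rV[R]_n => x 0 k)}.
  exact: coord_continuous.
case=> [|j]; split=> // i; split.
  by move=> x _; apply: diff_derivable; exact: differentiable_coord.
by rewrite partial_coord; exact: smooth_cst.
Qed.

Section Partial.
Context (x : 'rV[R]_n) (Ux : U x) (i : 'I_n).

Lemma partial_cst (c : R) : partial i (fun=> c) x = 0.
Proof. by rewrite /partial derive_cst. Qed.

Lemma partial_add u v : smooth_on U u -> smooth_on U v ->
  partial i (fun x => u x + v x) x = partial i u x + partial i v x.
Proof.
by move=> su sv; rewrite /partial -deriveD //; exact: smooth_derivable.
Qed.

Lemma partial_mul u v : smooth_on U u -> smooth_on U v ->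
  partial i (fun x => u x * v x) x = partial i u x * v x + u x * partial i v x.
Proof.
move=> su sv; rewrite /partial deriveM; try exact: smooth_derivable.
by rewrite /GRing.scale /= addrC [v x * _]mulrC.
Qed.

Lemma partial_opp u : smooth_on U u ->
  partial i (fun x => - u x) x = - partial i u x.
Proof. by move=> su; rewrite /partial -deriveN //; exact: smooth_derivable. Qed.

Lemma partial_sum (I : Type) (r : seq I) (u : I -> 'rV[R]_n -> R) :
  (forall j, smooth_on U (u j)) ->
  partial i (fun x => \sum_(j <- r) u j x) x = \sum_(j <- r) partial i (u j) x.
Proof.
move=> su; elim: r => [|j r IHr].
  rewrite big_nil -[RHS](partial_cst 0); congr partial.
  by apply/funext => y; rewrite big_nil.
rewrite big_cons -IHr -partial_add //; last exact: smooth_sum.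
by congr partial; apply/funext => y; rewrite big_cons.
Qed.

End Partial.

Lemma smooth_det k (A : 'rV[R]_n -> 'M[R]_k) :
  (forall i j, smooth_on U (fun x => A x i j)) ->
  smooth_on U (fun x => \det (A x)).
Proof.
move=> sA; apply: smooth_sum => s _; apply: smooth_mul => //.
  exact: smooth_cst.
exact: smooth_prod.
Qed.

(** By Cramer's rule the entries of the inverse are cofactors divided by the
    determinant. *)
Lemma smooth_invmx k (A : 'rV[R]_n -> 'M[R]_k) :
  (forall x, U x -> A x \in unitmx) ->
  (forall i j, smooth_on U (fun x => A x i j)) ->
  forall i j, smooth_on U (fun x => invmx (A x) i j).
Proof.
move=> uA sA i j.
apply: (@eq_smooth (fun x => (\det (A x))^-1 * cofactor (A x) j i)).
  by move=> x Ux; rewrite /invmx uA // !mxE.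
apply: smooth_mul => //.
  apply: smooth_inv; last exact: smooth_det.
  by move=> x Ux; rewrite -unitfE -[_ \is a _]/(A x \in unitmx) uA.
apply: smooth_mul => //; first exact: smooth_cst.
apply: smooth_det => a b.
apply: (@eq_smooth (fun x => A x (lift j a) (lift i b))) => // x _.
by rewrite !mxE.
Qed.

End SmoothCalculus.

(** * Directional derivatives and the second derivative test *)

Section Directional.
Context (R : realType).

(** Absolute values make the statement independent of the sign of [b], since
    the increments of [is_derive_add_delta] have no definite sign. *)
Lemma mvt_from_0 (g dg : R -> R) (b : R) :
  (forall t : R, `|t| <= `|b| -> is_derive t 1 g (dg t)) ->
  exists2 c, `|c| <= `|b| & g b - g 0 = dg c * b.
Proof.
move=> dgP.
have gc t : `|t| <= `|b| -> {for t, continuous g}.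
  move=> /dgP[d _]; apply: differentiable_continuous; exact/derivable1_diffP.
have [b0|b0] := leP 0 b.
  have bb t : t \in `[0, b]%R -> `|t| <= `|b|.
    by rewrite in_itv /= => /andP[t0 tb]; rewrite !ger0_norm.
  have [||c cb ->] := @MVT_segment _ g dg 0 b b0.
  - by move=> t tb; apply/dgP/bb; apply: subset_itv_oo_cc tb.
  - by apply: continuous_in_subspaceT => t /set_mem tb; apply/gc/bb.
  - by exists c; [exact: bb | rewrite subr0].
have bb t : t \in `[b, 0]%R -> `|t| <= `|b|.
  rewrite in_itv /= => /andP[t0 tb].
  by rewrite (ler0_norm tb) (ltr0_norm b0) lerN2.
have [||c cb /eqP] := @MVT_segment _ g dg b 0 (ltW b0).
- by move=> t tb; apply/dgP/bb; apply: subset_itv_oo_cc tb.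
- by apply: continuous_in_subspaceT => t /set_mem tb; apply/gc/bb.
- move=> gE; exists c; first exact: bb.
  by rewrite -[LHS]opprB (eqP gE) sub0r mulrN opprK.
Qed.

Context (n : nat).
Implicit Types (u : 'rV[R]_n -> R) (x v w : 'rV[R]_n).

Lemma is_derive_line u w x t : derivable u (t *: w + x) w ->
  is_derive t 1 (fun s : R => u (s *: w + x)) ('D_w u (t *: w + x)).
Proof.
move=> du.
have E : (fun h : R => h^-1 *:
    (((fun s : R => u (s *: w + x)) \o shift t) (h *: 1) - u (t *: w + x))) =
  (fun h : R => h^-1 *: ((u \o shift (t *: w + x)) (h *: w) - u (t *: w + x))).
  by apply/funext => h /=; rewrite [h *: 1]mulr1 scalerDl addrA.
split; first by rewrite /derivable E.
by rewrite /derive E.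
Qed.

(** The inductive step of the theorem that a function with continuous partial
    derivatives has the expected derivative in every direction: an increment
    along [v + c e_k] is one along [v] followed by one along [e_k], and the
    latter is given by the mean value theorem and the continuity at [x] of the
    [k]-th partial derivative. *)
Lemma is_derive_add_delta u x v (k : 'I_n) (c : R) :
  derivable u x v ->
  (\forall y \near x, derivable u y (delta_mx 0 k)) ->
  {for x, continuous (partial k u)} ->
  is_derive x (v + c *: delta_mx 0 k) u ('D_v u x + c * partial k u x).
Proof.
move=> dv dk ck; set e := delta_mx 0 k.
pose F (h : R) := h^-1 *: (u (h *: v + x) - u x) +
  h^-1 *: (u (h *: (v + c *: e) + x) - u (h *: v + x)).
have FE : (fun h : R => h^-1 *: ((u \o shift x) (h *: (v + c *: e)) - u x)) = F.
  by apply/funext => h; rewrite /F /= -scalerDr; congr (_ *: _); ring.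
suff cF : F h @[h --> 0^'] --> 'D_v u x + c * partial k u x.
  split.
    rewrite /derivable FE; apply/cvg_ex.
    by exists ('D_v u x + c * partial k u x).
  by rewrite /derive FE; apply/cvg_lim.
apply: cvgD; first exact: dv.
apply/cvgrPdist_le => eps eps0.
have c1 : 0 < `|c| + 1 by rewrite ltr_wpDl.
have near_r : \forall y \near x, derivable u y e /\
    `|partial k u x - partial k u y| <= eps / (`|c| + 1).
  near=> y; split; first by near: y.
  near: y; move/cvgrPdist_le: ck; apply; exact: divr_gt0.
have [r /= r0 rP] := (nbhs_ballP _ _).1 near_r.
(* For [|h| < r / V] the whole segment of length [|h c|] in the direction [e]
   starting at [x + h v] stays in the ball of radius [r]. *)
pose V := `|v| + `|c| * `|e| + 1.
have V0 : 0 < V by rewrite ltr_wpDl // addr_ge0 // mulr_ge0.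
near=> h.
have h0 : h != 0 by near: h; exact: nbhs_dnbhs_neq.
have hr : `|h| < r / V.
  by near: h; apply: dnbhs0_lt; exact: divr_gt0.
have inr t : `|t| <= `|h * c| -> ball x r (t *: e + (h *: v + x)).
  move=> th; rewrite -ball_normE /ball_ /=.
  rewrite addrA opprD addrCA subrr addr0 normrN.
  apply: le_lt_trans (ler_normD _ _) _; rewrite !normrZ.
  apply: (@le_lt_trans _ _ (`|h| * V)); last by rewrite -ltr_pdivlMr.
  rewrite /V !mulrDr mulr1 mulrA -normrM addrC.
  by rewrite -[leLHS]addr0 lerD // lerD2l ler_wpM2r.
have [t th tE] := @mvt_from_0 (fun s => u (s *: e + (h *: v + x)))
  (fun s => partial k u (s *: e + (h *: v + x))) (h * c)
  (fun t th => is_derive_line (rP _ (inr t th)).1).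
have -> : h *: (v + c *: e) + x = (h * c) *: e + (h *: v + x).
  by rewrite scalerDr scalerA addrA [(h * c) *: e + _]addrC.
move: tE; rewrite scale0r add0r => ->.
have -> : h^-1 *: (partial k u (t *: e + (h *: v + x)) * (h * c)) =
    c * partial k u (t *: e + (h *: v + x)).
  by rewrite /GRing.scale /=; field.
rewrite -mulrBr normrM.
apply: (@le_trans _ _ (`|c| * (eps / (`|c| + 1)))).
  by rewrite ler_wpM2l // (rP _ (inr t th)).2.
by rewrite mulrA ler_pdivrMr // mulrC ler_pM2l // lerDl.
Unshelve. all: by end_near. Qed.

Context (U : set 'rV[R]_n) (oU : open U).

Lemma is_derive_smooth u x v : smooth_on U u -> U x ->
  is_derive x v u (\sum_i v 0 i * partial i u x).
Proof.
move=> su Ux.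
suff H (s : seq 'I_n) : is_derive x (\sum_(i <- s) v 0 i *: delta_mx 0 i) u
    (\sum_(i <- s) v 0 i * partial i u x).
  by have := H (index_enum _); rewrite -row_sum_delta.
elim: s => [|i s [d1 d2]]; first by rewrite !big_nil; exact: is_derive0.
rewrite !big_cons addrC [X in is_derive _ _ _ X]addrC -d2.
apply: is_derive_add_delta => //.
- near=> y; apply: (smooth_derivable su); near: y; exact: (near_open oU Ux).
- exact: smooth_continuous (smooth_partial i su) Ux.
Unshelve. all: by end_near. Qed.

Lemma smooth_derive u v : smooth_on U u -> smooth_on U ('D_v u).
Proof.
move=> su; apply: (@eq_smooth _ _ _ oU (fun x => \sum_i v 0 i * partial i u x)).
  by move=> x Ux; have [_ ->] := is_derive_smooth v su Ux.
apply: smooth_sum => // i _; apply: smooth_mul => //; first exact: smooth_cst.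
exact: smooth_partial.
Qed.

Lemma derive2_smooth u x v : smooth_on U u -> U x ->
  'D_v ('D_v u) x =
  \sum_i \sum_j v 0 i * v 0 j * partial i (partial j u) x.
Proof.
move=> su Ux; have [_ ->] := is_derive_smooth v (smooth_derive v su) Ux.
apply: eq_bigr => i _.
rewrite (@eq_partial _ _ _ oU _ (fun x => \sum_j v 0 j * partial j u x)) //;
  last first.
  by move=> y Uy; have [_ ->] := is_derive_smooth v su Uy.
have sp j : smooth_on U (partial j u) by exact: smooth_partial.
rewrite (partial_sum oU Ux) => [|j]; last first.
  by apply: smooth_mul => //; exact: smooth_cst.
rewrite mulr_sumr; apply: eq_bigr => j _.
rewrite (partial_mul Ux) ?partial_cst; [by ring| |by []].
exact: smooth_cst.
Qed.

(** The restriction of [u] to the line [t |-> t v + x] has a maximum at [0], so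
    its derivative vanishes there. If its second derivative were positive, its
    derivative would be positive on the right of [0], and the mean value theorem
    would give larger values of [u]. *)
Lemma derive_at_max u x v : smooth_on U u -> U x ->
  (\forall y \near x, u y <= u x) ->
  'D_v u x = 0 /\ 'D_v ('D_v u) x <= 0.
Proof.
move=> su Ux umax; set W := 'D_v u; pose l (t : R) := t *: v + x.
have l0 : l 0 = x by rewrite /l scale0r add0r.
have cl : {for 0, continuous l}.
  apply: continuousD; last exact: cst_continuous.
  exact: scalel_continuous.
have near_l : \forall t \near 0, U (l t) /\ u (l t) <= u x.
  apply: (cl [set y | U y /\ u y <= u x]); rewrite l0.
  near=> y; split; near: y => //; exact: (near_open oU Ux).
have [d /= d0 dP] := (nbhs_ballP _ _).1 near_l.
have dl t : `|t| < d -> U (l t) /\ u (l t) <= u x.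
  by move=> td; apply: dP; rewrite -ball_normE /ball_ /= sub0r normrN.
have gP (t : R) : `|t| < d -> is_derive t 1 (u \o l) (W (l t)).
  move=> /dl[Ut _]; apply: is_derive_line.
  by have [] := is_derive_smooth v su Ut.
have itvd t : t \in `]- d, d[%R -> `|t| < d by rewrite in_itv /= ltr_norml.
have W0 : W x = 0.
  have [_ <-] : is_derive (0 : R) 1 (u \o l) 0.
    apply: (@derive1_at_max _ _ (- d) d); first by rewrite ge0_cp // ltW.
    - by move=> t /itvd/gP[].
    - by rewrite in_itv /= oppr_lt0 d0.
    - by move=> t /itvd/dl[_]; rewrite /= l0.
  have n0 : `|0 : R| < d by rewrite normr0.
  by rewrite -[in LHS]l0; have [_ ->] := gP 0 n0.
split=> //; rewrite leNgt; apply/negP => D0.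
have sW := smooth_derive v su.
have [dW _] := is_derive_smooth v sW Ux.
have [e /= e0 eP] :
    \forall h \near 0^', 0 < h^-1 *: ((W \o shift x) (h *: v) - W x).
  exact: (cvgr_gt _ dW).
pose b := Num.min d e / 2.
have b0 : 0 < b by rewrite divr_gt0 // lt_min d0.
have [bd be] : b < d /\ b < e.
  by apply/andP; rewrite -lt_min /b ltr_pdivrMr // mulrDr mulr1 ltrDl lt_min d0.
have tb t : t \in `[0, b]%R -> `|t| < d.
  by rewrite in_itv /= => /andP[t0 tb]; rewrite ger0_norm // (le_lt_trans tb).
have [||c cb] := @MVT _ (u \o l) (W \o l) 0 b b0.
- by move=> t /subset_itv_oo_cc/tb/gP.
- apply: continuous_in_subspaceT => t /set_mem/tb/gP[dg _].
  by apply: differentiable_continuous; exact/derivable1_diffP.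
have c0 : 0 < c by have := cb; rewrite in_itv => /andP[].
have := eP c; rewrite /ball_ /= sub0r normrN gtr0_norm // W0 subr0 => Wc.
have {}Wc : 0 < W (l c).
  have /Wc : c < e.
    by rewrite (lt_trans _ be) //; have := cb; rewrite in_itv => /andP[].
  by move=> /(_ (lt0r_neq0 c0)); rewrite pmulr_rgt0 // invr_gt0.
rewrite /= l0 subr0 => uE.
have : 0 < u (l b) - u x by rewrite uE mulr_gt0.
rewrite subr_gt0 ltNge; have [|_ -> //] := dl b.
by rewrite gtr0_norm.
Unshelve. all: by end_near. Qed.

End Directional.

(** * Positive definite matrices and Euclidean distances *)

Section PositiveDefinite.
Context (R : realType).

Definition spd n (A : 'M[R]_n) :=
  A^T = A /\ forall v : 'rV[R]_n, v != 0 -> 0 < (v *m A *m v^T) 0 0.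

Lemma spd_unitmx n (A : 'M[R]_n) : spd A -> A \in unitmx.
Proof.
move=> [_ pA]; rewrite -row_free_unit -kermx_eq0.
apply/rowV0P => v /sub_kermxP vA; apply/eqP; apply: contraT => /pA.
by rewrite vA mul0mx mxE ltxx.
Qed.

Lemma spd_invmx n (A : 'M[R]_n) : spd A -> spd (invmx A).
Proof.
move=> sA; have uA := spd_unitmx sA; have [tA pA] := sA.
split=> [|v v0]; first by rewrite trmx_inv tA.
have := pA (v *m invmx A); rewrite mulmxKV // trmx_mul trmx_inv tA mulmxA.
apply; apply: contraNneq v0 => vA.
by rewrite -(mulmxKV uA v) vA mul0mx.
Qed.

(** Complete the square in the first variable: the Schur complement of the
    upper left coefficient is again symmetric positive definite. *)
Lemma cholesky n (A : 'M[R]_n) : spd A -> exists P : 'M[R]_n, A = P^T *m P.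
Proof.
elim: n A => [|n IHn] A [tA pA].
  by exists 0; apply/matrixP => -[].
rewrite -[n.+1]/(1 + n)%N in A tA pA *.
set a := A 0 0; set b := ursubmx A; set D := drsubmx A.
have AE : A = block_mx a%:M b b^T D.
  rewrite -[LHS]submxK -/b -/D; congr (block_mx _ _ _ _).
    apply/matrixP => i j; rewrite !ord1 !mxE /= mulr1n /a.
    by congr (A _ _); apply/val_inj.
  by rewrite /b -[in RHS]tA; apply/matrixP => i j; rewrite !mxE.
have a0 : 0 < a.
  have := pA (row_mx 1%:M 0); rewrite AE mul_row_block tr_row_mx mul_row_col.
  rewrite !(mul0mx, mulmx0, trmx0, addr0) !mul1mx trmx1 mulmx1 mxE mulr1n.
  apply.
  by rewrite row_mx_eq0 negb_and -scalemx1 scale1r matrix_nonzero1.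
have tD : D^T = D by rewrite /D -[in RHS]tA; apply/matrixP => i j; rewrite !mxE.
pose S := D - a^-1 *: (b^T *m b).
have [Q SQ] : exists Q : 'M[R]_n, S = Q^T *m Q.
  apply: IHn; split.
    by rewrite /S linearB /= tD linearZ /= trmx_mul trmxK.
  (* The first coordinate is the one minimizing the quadratic form of [A]
     when the others are those of [y]. *)
  move=> y y0; have := pA (row_mx (- a^-1 *: (y *m b^T)) y).
  rewrite AE mul_row_block tr_row_mx mul_row_col.
  have -> : - a^-1 *: (y *m b^T) *m a%:M + y *m b^T = 0.
    rewrite mul_mx_scalar scalerA mulrN divff ?gt_eqF //.
    by rewrite scaleN1r addNr.
  have -> : - a^-1 *: (y *m b^T) *m b + y *m D = y *m S.
    by rewrite /S mulmxBr -scalemxAr mulmxA -scalemxAl scaleNr addrC.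
  by rewrite mul0mx add0r; apply; rewrite row_mx_eq0 negb_and y0 orbT.
have s0 : Num.sqrt a != 0 by rewrite gt_eqF // sqrtr_gt0.
have s2 : Num.sqrt a * Num.sqrt a = a by rewrite -expr2 sqr_sqrtr // ltW.
exists (block_mx (Num.sqrt a)%:M ((Num.sqrt a)^-1 *: b) 0 Q).
rewrite tr_block_mx mulmx_block !(trmx0, mul0mx, mulmx0, addr0) AE.
rewrite tr_scalar_mx -scalar_mxM s2 mul_scalar_mx scalerA divff // scale1r.
rewrite linearZ /= mul_mx_scalar scalerA divff // scale1r.
rewrite -scalemxAl -scalemxAr scalerA -invfM s2 -SQ /S.
by rewrite addrC subrK.
Qed.

(** If [A = P^T P], the contraction is the sum of the values of the quadratic
    form of [H] at the rows of [P]. *)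
Lemma spd_contract_le0 n (A : 'M[R]_n) (H : 'I_n -> 'I_n -> R) : spd A ->
  (forall v : 'rV[R]_n, \sum_i \sum_j v 0 i * v 0 j * H i j <= 0) ->
  \sum_i \sum_j A i j * H i j <= 0.
Proof.
move=> /cholesky[P ->] nH.
have -> : \sum_i \sum_j (P^T *m P) i j * H i j =
    \sum_k \sum_i \sum_j row k P 0 i * row k P 0 j * H i j.
  rewrite [RHS]exchange_big /=; apply: eq_bigr => i _.
  rewrite [RHS]exchange_big /=; apply: eq_bigr => j _.
  rewrite mxE mulr_suml; apply: eq_bigr => k _.
  by rewrite !mxE.
by apply: sumr_le0 => k _; exact: nH.
Qed.

End PositiveDefinite.

Section EuclideanSquare.
Context (R : realType) (n : nat).
Implicit Types x y z : 'rV[R]_n.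

Definition sqnorm (x : 'rV[R]_n) : R := \sum_i x 0 i ^+ 2.

Lemma sqnorm_eq0 x : sqnorm x <= 0 -> x = 0.
Proof.
move=> x0; apply/rowP => i; rewrite mxE; apply/eqP; rewrite -sqrf_eq0.
rewrite eq_le sqr_ge0 andbT (le_trans _ x0) // /sqnorm (bigD1 i) //= lerDl.
by apply: sumr_ge0 => j _; exact: sqr_ge0.
Qed.

(** The norm of row vectors is the supremum norm, whereas the touching balls
    of the maximum principle have to be Euclidean: their boundary must be
    smooth. *)
Lemma norm_sqnorm x : `|x| ^+ 2 <= sqnorm x.
Proof.
have H i : `|x 0 i| <= Num.sqrt (sqnorm x).
  rewrite -sqrtr_sqr ler_wsqrtr // /sqnorm (bigD1 i) //= lerDl.
  by apply: sumr_ge0 => j _; exact: sqr_ge0.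
have q0 : 0 <= sqnorm x by apply: sumr_ge0 => j _; exact: sqr_ge0.
rewrite -[leRHS](sqr_sqrtr q0) ler_pXn2r ?nnegrE ?sqrtr_ge0 //.
rewrite [leLHS]/Num.norm /= mx_normrE; apply: bigmax_le; first exact: sqrtr_ge0.
by move=> [i j] _ /=; rewrite ord1.
Qed.

Lemma smooth_sqdist (U : set 'rV[R]_n) c : open U ->
  smooth_on U (fun x => sqnorm (x - c)).
Proof.
move=> oU; apply: smooth_sum => // i _.
have sc : smooth_on U (fun x : 'rV[R]_n => x 0 i + - c 0 i).
  by apply: smooth_add => //; [exact: smooth_coord | exact: smooth_cst].
apply: (@eq_smooth _ _ _ oU (fun x => (x 0 i + - c 0 i) * (x 0 i + - c 0 i))).
  by move=> x _; rewrite !mxE expr2.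
exact: smooth_mul.
Qed.

Lemma partial_sqdist c i :
  partial i (fun x => sqnorm (x - c)) = fun x => 2 * (x 0 i - c 0 i).
Proof.
apply/funext => x; have oT := @openT 'rV[R]_n.
have sc j : smooth_on setT (fun x : 'rV[R]_n => x 0 j + - c 0 j).
  by apply: smooth_add => //; [exact: smooth_coord | exact: smooth_cst].
have dc j : partial i (fun x : 'rV[R]_n => x 0 j + - c 0 j) x = (i == j)%:R.
  rewrite (partial_add (U := setT)) //;
    [|exact: smooth_coord|exact: smooth_cst].
  by rewrite partial_coord partial_cst addr0.
transitivity (partial i
    (fun x => \sum_j (x 0 j + - c 0 j) * (x 0 j + - c 0 j)) x).
  congr partial; apply/funext => y; apply: eq_bigr => j _.
  by rewrite !mxE expr2.
rewrite (partial_sum oT) //; last by move=> j; exact: smooth_mul.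
rewrite (bigD1 i) //= big1 => [|j ji].
  rewrite (partial_mul (U := setT)) // dc eqxx mul1r mulr1 addr0.
  by rewrite mulr2n mulrDl !mul1r.
by rewrite (partial_mul (U := setT)) // dc eq_sym (negPf ji) mul0r mulr0 addr0.
Qed.

Lemma continuous_sqdist c : continuous (fun x => sqnorm (x - c)).
Proof.
move=> x; exact: (smooth_continuous (U := setT) (smooth_sqdist c openT)).
Qed.

(** The parallelogram law around the midpoint of [y] and [z]; with
    [sqnorm_half] it says that the ball with diameter from [y] to [z] lies in
    the ball of centre [y] through [z] and touches its boundary at [z] only. *)
Lemma sqnorm_mid x y z : sqnorm (x - y) + sqnorm (x - z) =
  2 * sqnorm (x - 2^-1 *: (y + z)) + 2^-1 * sqnorm (z - y).
Proof.
rewrite /sqnorm !mulr_sumr -!big_split; apply: eq_bigr => i _ /=.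
by rewrite !mxE; field.
Qed.

Lemma sqnorm_half y z : sqnorm (z - 2^-1 *: (y + z)) = 4^-1 * sqnorm (z - y).
Proof.
rewrite /sqnorm !mulr_sumr; apply: eq_bigr => i _ /=.
by rewrite !mxE; field.
Qed.

Lemma sqnorm_triangle x y z :
  sqnorm (x - z) <= 2 * (sqnorm (x - y) + sqnorm (y - z)).
Proof.
rewrite /sqnorm mulrDr !mulr_sumr -!big_split; apply: ler_sum => i _ /=.
rewrite !mxE -subr_ge0 [leRHS](_ : _ = (x 0 i - 2 * y 0 i + z 0 i) ^+ 2).
  exact: sqr_ge0.
by ring.
Qed.

Lemma sqnormC x y : sqnorm (x - y) = sqnorm (y - x).
Proof. by apply: eq_bigr => i _; rewrite -opprB !mxE sqrrN. Qed.

Lemma compact_cball z r : 0 < r -> compact [set x | `|z - x| <= r].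
Proof.
move=> r0; have E : [set x | `|z - x| <= r] = closed_ball z r.
  by rewrite closed_ballE.
apply: bounded_closed_compact; last by rewrite E; exact: closed_ball_closed.
exists (`|z| + r); split; first exact: num_real.
move=> t tr x /= zx; rewrite (le_trans _ (ltW tr)) //.
by rewrite -(subKr z x) (le_trans (ler_normB _ _)) // lerD2l.
Qed.

End EuclideanSquare.

(** * The strong maximum principle in coordinates *)

Section MaximumPrinciple.
Context (R : realType) (n : nat) (U : set 'rV[R]_n) (oU : open U).
Context (a : 'rV[R]_n -> 'M[R]_n) (b : 'I_n -> 'rV[R]_n -> R).
Context (a_spd : forall x, U x -> spd (a x)).
Context (a_smooth : forall i j, smooth_on U (fun x => a x i j)).
Context (b_smooth : forall i, smooth_on U (b i)).
Implicit Types (u v : 'rV[R]_n -> R) (x z c : 'rV[R]_n).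

Definition elliptic u x : R :=
  \sum_i \sum_j a x i j * partial i (partial j u) x
  + \sum_i b i x * partial i u x.

Lemma smooth_elliptic u : smooth_on U u -> smooth_on U (elliptic u).
Proof.
move=> su; apply: smooth_add => //.
  apply: smooth_sum => // i _; apply: smooth_sum => // j _.
  by apply: smooth_mul => //; do 2 apply: smooth_partial.
by apply: smooth_sum => // i _; apply: smooth_mul => //; exact: smooth_partial.
Qed.

Lemma ellipticD u v (e : R) x : smooth_on U u -> smooth_on U v -> U x ->
  elliptic (fun y => u y + e * v y) x = elliptic u x + e * elliptic v x.
Proof.
move=> su sv Ux.
have D1 w w' i y : smooth_on U w -> smooth_on U w' -> U y ->
    partial i (fun y => w y + e * w' y) y = partial i w y + e * partial i w' y.
  move=> sw sw' Uy.
  have se : smooth_on U (fun=> e) by exact: smooth_cst.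
  rewrite (partial_add Uy) //; last exact: smooth_mul.
  by rewrite (partial_mul Uy) // partial_cst mul0r add0r.
rewrite /elliptic mulrDr addrACA; congr (_ + _).
  rewrite mulr_sumr -big_split; apply: eq_bigr => i _ /=.
  rewrite mulr_sumr -big_split; apply: eq_bigr => j _ /=.
  rewrite (@eq_partial _ _ _ oU _
    (fun y => partial j u y + e * partial j v y)) //.
    rewrite D1 //; try exact: smooth_partial.
    by rewrite mulrDr mulrCA.
  by move=> y Uy; rewrite D1.
rewrite mulr_sumr -big_split; apply: eq_bigr => i _ /=.
by rewrite D1 // mulrDr mulrCA.
Qed.

(** At a maximum the gradient vanishes and the Hessian is nonpositive. *)
Lemma elliptic_max u x : smooth_on U u -> U x ->
  (\forall y \near x, u y <= u x) -> elliptic u x <= 0.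
Proof.
move=> su Ux umax; rewrite /elliptic [X in _ + X]big1 ?addr0; last first.
  move=> i _; rewrite /partial.
  by have [-> _] := derive_at_max oU (delta_mx 0 i) su Ux umax; rewrite mulr0.
apply: spd_contract_le0; first exact: a_spd.
move=> v; rewrite -(derive2_smooth oU) //.
by have [_] := derive_at_max oU v su Ux umax.
Qed.

(** Take [v = s + K s^2], where [s x = |z - c|^2 - |x - c|^2] is positive inside
    the ball of centre [c] through [z]. At [z] the square contributes
    [2 K a(ds, ds)], which dominates the other terms when [K] is large since
    [ds] does not vanish there; and [v = s (1 + K s)] has the sign of [s] near
    [z]. *)
Lemma barrier z c : U z -> c != z ->
  exists v, [/\ smooth_on U v, v z = 0, 0 < elliptic v z &
    \forall x \near z, sqnorm (z - c) < sqnorm (x - c) -> v x < 0].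
Proof.
move=> Uz cz.
pose y := z - c; have y0 : y != 0 by rewrite subr_eq0 eq_sym.
pose A := (y *m a z *m y^T) 0 0.
have A0 : 0 < A by exact: (a_spd Uz).2.
have AE : A = \sum_i \sum_j a z i j * (y 0 i * y 0 j).
  rewrite /A mxE exchange_big; apply: eq_bigr => j _ /=.
  by rewrite !mxE mulr_suml; apply: eq_bigr => i _; rewrite !mxE; ring.
(* [- 2 T] is the value at [z] of the operator on [s], and [8 K A] is the
   contribution of [K s^2]. *)
pose T := \sum_i a z i i + \sum_i b i z * y 0 i.
pose K := (`|T| + 1) / (4 * A).
have K0 : 0 < K by rewrite divr_gt0 ?mulr_gt0 // ltr_wpDl.
pose s x := sqnorm (z - c) + - sqnorm (x - c).
have ss (V : set 'rV[R]_n) : open V -> smooth_on V s.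
  move=> oV; apply: smooth_add => //; first exact: smooth_cst.
  by apply: smooth_opp => //; exact: smooth_sqdist.
have oT := @openT 'rV[R]_n.
have ds i : partial i s = fun x => - (2 * (x 0 i - c 0 i)).
  apply/funext => x; rewrite (partial_add (U := setT)) //.
  - rewrite partial_cst add0r (partial_opp (U := setT)) ?partial_sqdist //.
    exact: smooth_sqdist.
  - exact: smooth_cst.
  - by apply: smooth_opp => //; exact: smooth_sqdist.
have dds i j x : partial i (partial j s) x = - (2 * (i == j)%:R).
  rewrite ds.
  have sl V : open V -> smooth_on V (fun x : 'rV[R]_n => x 0 j + - c 0 j).
    move=> oV; apply: smooth_add => //; last exact: smooth_cst.
    exact: smooth_coord.
  have s2 V : smooth_on V (fun=> 2 : R) by exact: smooth_cst.
  rewrite (partial_opp (U := setT)) //; last first.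
    by apply: smooth_mul => //; exact: sl.
  rewrite (partial_mul (U := setT)) //; last exact: sl.
  rewrite partial_cst mul0r add0r (partial_add (U := setT)) //.
  - by rewrite partial_coord partial_cst addr0.
  - exact: smooth_coord.
  - exact: smooth_cst.
pose k x := 1 + K * s x.
have sk (V : set 'rV[R]_n) : open V -> smooth_on V k.
  move=> oV; apply: smooth_add => //; first exact: smooth_cst.
  by apply: smooth_mul => //; [exact: smooth_cst|exact: ss].
have dk i x : partial i k x = K * partial i s x.
  rewrite (partial_add (U := setT)) //.
  - rewrite partial_cst add0r (partial_mul (U := setT)) //.
    + by rewrite partial_cst mul0r add0r.
    + exact: smooth_cst.
    + exact: ss.
  - exact: smooth_cst.
  - by apply: smooth_mul => //; [exact: smooth_cst|exact: ss].
pose v x := s x * k x.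
have sv (V : set 'rV[R]_n) : open V -> smooth_on V v.
  by move=> oV; apply: smooth_mul => //; [exact: ss|exact: sk].
have dv i : partial i v = fun x => (k x + K * s x) * partial i s x.
  apply/funext => x.
  rewrite (partial_mul (U := setT)) //; [|exact: ss|exact: sk].
  by rewrite dk; ring.
have sz : s z = 0 by rewrite /s subrr.
have kz : k z = 1 by rewrite /k sz mulr0 addr0.
exists v; split; first exact: sv.
- by rewrite /v sz mul0r.
- have ddv i j : partial i (partial j v) z =
      8 * K * (y 0 i * y 0 j) - 2 * (i == j)%:R.
    rewrite dv.
    have s1 : smooth_on setT (fun x => k x + K * s x).
      apply: smooth_add => //; first exact: sk.
      by apply: smooth_mul => //; [exact: smooth_cst|exact: ss].
    rewrite (partial_mul (U := setT)) //; last first.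
      by apply: smooth_partial; exact: ss.
    rewrite (partial_add (U := setT)) //; [|exact: sk| ]; last first.
      by apply: smooth_mul => //; [exact: smooth_cst|exact: ss].
    rewrite (partial_mul (U := setT)) //; [|exact: smooth_cst|exact: ss].
    rewrite partial_cst dk dds kz sz !ds /y !mxE; ring.
  have -> : elliptic v z = 8 * K * A - 2 * T.
    rewrite AE mulr_sumr /T mulrDr !mulr_sumr opprD addrA; congr (_ + _).
      rewrite -sumrB; apply: eq_bigr => i _.
      have -> : 2 * a z i i = \sum_j a z i j * (2 * (i == j)%:R).
        rewrite (bigD1 i) //= big1 ?addr0; first by rewrite eqxx mulr1 mulrC.
        by move=> j ji; rewrite eq_sym (negPf ji) !mulr0.
      rewrite mulr_sumr -sumrB; apply: eq_bigr => j _.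
      by rewrite ddv mulrBr; congr (_ - _); ring.
    rewrite -sumrN; apply: eq_bigr => i _.
    rewrite dv kz sz ds /y !mxE; ring.
  have -> : 8 * K * A = 2 * (`|T| + 1) by rewrite /K; field; rewrite gt_eqF.
  by rewrite -mulrBr mulr_gt0 // subr_gt0 (le_lt_trans (ler_norm _)) // ltrDl.
- have ck : {for z, continuous k} by exact: (smooth_continuous (sk _ oU) Uz).
  near=> x => xc; rewrite /v nmulr_rlt0; last by rewrite subr_lt0.
  near: x; apply: (cvgr_gt _ ck).
  by rewrite kz.
Unshelve. all: by end_near. Qed.

Context (u : 'rV[R]_n -> R) (M : R).
Context (u_smooth : smooth_on U u).
Context (u_sub : forall x, U x -> 0 <= elliptic u x).
Context (u_le : forall x, U x -> u x <= M).

(** On the sphere of radius [r] around [z], the perturbation [w = u + e v] is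
    less than [M]: outside of the ball of centre [c] because [v < 0], and in
    that ball because [u <= M - del] on a compact set and [e] is small. As
    [w z = M], the maximum of [w] on the ball of radius [r] around [z] is
    interior, where [elliptic w > 0] contradicts [elliptic_max]. *)
Lemma hopf_touching z c : U z -> u z = M -> c != z ->
  (\forall x \near z, u x = M -> sqnorm (x - c) <= sqnorm (z - c) -> x = z) ->
  False.
Proof.
move=> Uz uz cz touch.
have [v [sv vz Lv0 vneg]] := barrier Uz cz.
have cLv := smooth_continuous (smooth_elliptic sv) Uz.
have cu x : U x -> {for x, continuous u} by exact: smooth_continuous.
have cv x : U x -> {for x, continuous v} by exact: smooth_continuous.
have near_z : \forall x \near z, [/\ U x, 0 < elliptic v x,
   sqnorm (z - c) < sqnorm (x - c) -> v x < 0 &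
   u x = M -> sqnorm (x - c) <= sqnorm (z - c) -> x = z].
  near=> x; split; near: x => //; first exact: near_open.
  exact: (cvgr_gt _ cLv).
have [d /= d0 dP] := (nbhs_ballP _ _).1 near_z.
pose r := d / 2; have r0 : 0 < r by rewrite divr_gt0.
pose N := [set x | `|z - x| <= r].
have NP x : N x -> [/\ U x, 0 < elliptic v x,
   sqnorm (z - c) < sqnorm (x - c) -> v x < 0 &
   u x = M -> sqnorm (x - c) <= sqnorm (z - c) -> x = z].
  move=> Nx; apply: dP; rewrite -ball_normE /ball_ /=.
  by rewrite (le_lt_trans Nx) // /r ltr_pdivrMr // ltr_pMr // ltr1n.
have cN : compact N by exact: compact_cball.
have Nz : N z by rewrite /N /= subrr normr0 ltW.
have N0 : N !=set0 by exists z.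
have within_N (A : set 'rV[R]_n) w : A `<=` N ->
    (forall x, U x -> {for x, continuous w}) ->
    {within A, continuous (w : _ -> R)}.
  by move=> AN cw; apply: continuous_in_subspaceT => x /set_mem/AN/NP[/cw].
pose C := N `&` ([set x | r <= `|z - x|] `&`
                 [set x | sqnorm (x - c) <= sqnorm (z - c)]).
have cC : compact C.
  apply: compact_closedI => //; apply: closedI.
    apply: (@closed_comp _ _ (fun x => `|z - x|) [set t | r <= t]);
      last exact: closed_ge.
    move=> x _; apply: continuous_comp; last exact: norm_continuous.
    by apply: continuousB => //; exact: cst_continuous.
  apply: (@closed_comp _ _ (fun x => sqnorm (x - c))
    [set t | t <= sqnorm (z - c)]); last exact: closed_le.
  by move=> x _; exact: continuous_sqdist.
have [del del0 delP] : exists2 del, 0 < del & forall x, C x -> u x <= M - del.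
  have [[x0 Cx0]|C0] := pselect (C !=set0); last first.
    by exists 1 => // x Cx; case: C0; exists x.
  have sCN : C `<=` N by move=> x [].
  have [p /set_mem Cp pmax] :=
    compact_EVT_max (ex_intro _ _ Cx0) cC (within_N C u sCN cu).
  exists (M - u p).
    have [Np [/= rp cp]] := Cp; have [Up _ _ pz] := NP _ Np.
    rewrite subr_gt0 lt_neqAle u_le // andbT; apply/eqP => /pz /(_ cp) pE.
    by move: rp; rewrite pE subrr normr0 leNgt r0.
  by move=> x Cx; rewrite subKr pmax //; exact: mem_set.
have [p /set_mem Np pmax] :=
  compact_EVT_max N0 cN (within_N N v (@subset_refl _ N) cv).
have vp0 : 0 <= v p by rewrite -vz pmax //; exact: mem_set.
pose e := del / (2 * (v p + 1)).
have e0 : 0 < e by rewrite divr_gt0 // mulr_gt0 // ltr_wpDl.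
have ev : e * v p < del.
  rewrite /e mulrAC ltr_pdivrMr ?mulr_gt0 ?ltr_wpDl // ltr_pM2l //; lra.
pose w x := u x + e * v x.
have sw : smooth_on U w.
  by apply: smooth_add => //; apply: smooth_mul => //; exact: smooth_cst.
have cw x : U x -> {for x, continuous w} by exact: smooth_continuous.
have [q /set_mem Nq qmax] :=
  compact_EVT_max N0 cN (within_N N w (@subset_refl _ N) cw).
have [Uq Lvq vq _] := NP _ Nq.
have wq : M <= w q.
  by rewrite -[M]addr0 -{1}uz -(mulr0 e) -vz; apply: qmax; exact: mem_set.
have qr : `|z - q| < r.
  rewrite lt_neqAle Nq andbT; apply/eqP => qr.
  move: wq; rewrite leNgt => /negP; apply.
  have [qc|/vq vq0] := leP (sqnorm (q - c)) (sqnorm (z - c)).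
    have Cq : C q by split=> //; split=> //=; rewrite qr.
    have := delP _ Cq; rewrite /w; have : e * v q <= e * v p.
      by rewrite ler_pM2l // pmax //; exact: mem_set.
    lra.
  have := u_le Uq; have : e * v q < 0 by rewrite pmulr_rlt0.
  rewrite /w; lra.
have : elliptic w q <= 0.
  apply: elliptic_max => //.
  have : \forall x \near q, ball z r x.
    by apply: open_nbhs_nbhs; split; [exact: ball_open | rewrite -ball_normE].
  apply: filterS => x; rewrite -ball_normE /= => zx; apply: qmax.
  by apply: mem_set; exact: ltW.
by rewrite leNgt ellipticD // ltr_wpDl ?u_sub // mulr_gt0.
Unshelve. all: by end_near. Qed.

(** Suppose that [u y <> M] with [y] close to [x0], and let [z] be a point of
    [u = M] nearest to [y]. The ball of centre [y] through [z] has no point of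
    [u = M] inside, so the ball with diameter from [y] to [z] meets this set
    at [z] only, which [hopf_touching] forbids. *)
Lemma strong_maximum x0 : U x0 -> u x0 = M -> \forall x \near x0, u x = M.
Proof.
move=> Ux0 ux0.
have [d /= d0 dP] := (nbhs_ballP _ _).1 (near_open oU Ux0).
pose r := d / 2; have r0 : 0 < r by rewrite divr_gt0.
pose N := [set x | `|x0 - x| <= r].
have NU : N `<=` U.
  move=> x Nx; apply: dP; rewrite -ball_normE /ball_ /=.
  by rewrite (le_lt_trans Nx) // /r ltr_pdivrMr // ltr_pMr // ltr1n.
have near_N x : `|x0 - x| < r -> \forall y \near x, N y.
  move=> xr; have : \forall y \near x, ball x0 r y.
    by apply: open_nbhs_nbhs; split; [exact: ball_open | rewrite -ball_normE].
  by apply: filterS => y; rewrite -ball_normE /= => /ltW.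
have cN : compact N by exact: compact_cball.
have Nx0 : N x0 by rewrite /N /= subrr normr0 ltW.
pose E := N `&` [set x | u x = M].
have clE : closed E.
  move=> x cx; have Nx : N x.
    apply: (compact_closed (@norm_hausdorff _ _) cN).
    exact: (closure_subset (@subIsetl _ N [set x | u x = M])).
  split=> //=; apply/eqP; apply: contraT => uxM.
  have uxM' : u x < M by rewrite lt_neqAle uxM u_le //; exact: NU.
  have /cx[y [[_ /= uy]]] : \forall y \near x, u y < M.
    exact: (cvgr_lt _ (smooth_continuous u_smooth (NU _ Nx))).
  by rewrite uy ltxx.
have cE : compact E by apply: subclosed_compact clE cN _ => x [].
(* The factor [4] keeps the nearest point [z] inside the ball [N]: it is at
   distance at most [2 |y - x0|] from [x0]. *)
have near_q : \forall y \near x0, 4 * sqnorm (y - x0) < r ^+ 2.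
  have c0 := @continuous_sqdist _ _ x0 x0.
  have : \forall y \near x0, sqnorm (y - x0) < r ^+ 2 / 4.
    apply: (cvgr_lt _ c0).
    rewrite subrr /sqnorm big1 ?divr_gt0 ?exprn_gt0 // => i _.
    by rewrite mxE expr0n.
  by apply: filterS => y; rewrite ltr_pdivlMr // mulrC.
have := near_N x0; rewrite subrr normr0 => /(_ r0).
apply: filterS2 near_q => y qy /NU Uy.
apply/eqP; apply: contraT => uyM.
have E0 : E !=set0 by exists x0.
have [z /set_mem[Nz uz] zmin] := compact_EVT_min E0 cE
  (continuous_subspaceT (@continuous_sqdist _ _ y)).
have zr : `|x0 - z| < r.
  suff : `|x0 - z| ^+ 2 < r ^+ 2 by rewrite ltr_pXn2r ?nnegrE // ltW.
  apply: le_lt_trans (norm_sqnorm _) _; rewrite sqnormC.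
  have := sqnorm_triangle z y x0.
  have : sqnorm (z - y) <= sqnorm (x0 - y).
    by apply: zmin; apply: mem_set; split.
  by rewrite [sqnorm (x0 - y)]sqnormC; lra.
have zy : y != z by apply: contraNneq uyM => ->; rewrite uz.
have cz : 2^-1 *: (y + z) != z.
  apply: contraNneq zy => czE; apply/eqP/rowP => i.
  by move/rowP: czE => /(_ i); rewrite !mxE; lra.
exfalso; apply: (hopf_touching (NU _ Nz) uz cz).
have := near_N z zr; apply: filterS => x Nx ux xc.
apply/eqP; rewrite -subr_eq0; apply/eqP/sqnorm_eq0.
have : sqnorm (z - y) <= sqnorm (x - y) by apply: zmin; apply: mem_set; split.
have := sqnorm_mid x y z; have := sqnorm_half y z; move: xc.
by lra.
Qed.

End MaximumPrinciple.

(** * Curvature of a warped product in a product chart *)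

Section WarpedCoordinates.
Context (R : realType) (n m : nat).
Context (U : set 'rV[R]_n) (V : set 'rV[R]_m) (oU : open U) (oV : open V).
Context (g : 'rV[R]_n -> 'M[R]_n) (h : 'rV[R]_m -> 'M[R]_m) (f : 'rV[R]_n -> R).
Context (g_smooth : forall a b, smooth_on U (fun x => g x a b)).
Context (h_smooth : forall a b, smooth_on V (fun x => h x a b)).
Context (f_smooth : smooth_on U f).
Context (g_spd : forall x, U x -> spd (g x)).
Context (h_spd : forall x, V x -> spd (h x)).
Context (f_gt0 : forall x, U x -> 0 < f x).

Notation L := (lshift m).
Notation Rs := (@rshift n m).

Let W : set 'rV[R]_(n + m) := [set x | U (lsubmx x) /\ V (rsubmx x)].
Let G (x : 'rV[R]_(n + m)) : 'M[R]_(n + m) :=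
  block_mx (g (lsubmx x)) 0 0 (f (lsubmx x) ^+ 2 *: h (rsubmx x)).

Lemma warped_open : open W.
Proof.
have oc : open ((lsubmx : 'rV[R]_(n + m) -> _) @^-1` U).
  by apply: open_comp => // x _; exact: continuous_lsubmx.
have od : open ((rsubmx : 'rV[R]_(n + m) -> _) @^-1` V).
  by apply: open_comp => // x _; exact: continuous_rsubmx.
exact: openI oc od.
Qed.

Lemma partial_lshift_lsub a (p : 'rV[R]_n -> R) (x : 'rV[R]_(n + m)) :
  partial (L a) (fun y => p (lsubmx y)) x = partial a p (lsubmx x).
Proof. by rewrite partial_lsub (unsplitK (inl a)). Qed.

Lemma partial_rshift_lsub a (p : 'rV[R]_n -> R) (x : 'rV[R]_(n + m)) :
  partial (Rs a) (fun y => p (lsubmx y)) x = 0.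
Proof. by rewrite partial_lsub (unsplitK (inr a)). Qed.

Lemma partial_lshift_rsub a (p : 'rV[R]_m -> R) (x : 'rV[R]_(n + m)) :
  partial (L a) (fun y => p (rsubmx y)) x = 0.
Proof. by rewrite partial_rsub (unsplitK (inl a)). Qed.

Lemma partial_rshift_rsub a (p : 'rV[R]_m -> R) (x : 'rV[R]_(n + m)) :
  partial (Rs a) (fun y => p (rsubmx y)) x = partial a p (rsubmx x).
Proof. by rewrite partial_rsub (unsplitK (inr a)). Qed.

Section Separated.
Context (p : 'rV[R]_n -> R) (q : 'rV[R]_m -> R).
Context (sp : smooth_on U p) (sq : smooth_on V q).
Context (x : 'rV[R]_(n + m)) (Wx : W x).

Let sp' : smooth_on W (fun y => p (lsubmx y)).
Proof. by apply: smooth_lsub sp => y []. Qed.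

Let sq' : smooth_on W (fun y => q (rsubmx y)).
Proof. by apply: smooth_rsub sq => y []. Qed.

Lemma partial_lshift_mul a :
  partial (L a) (fun y => p (lsubmx y) * q (rsubmx y)) x =
  partial a p (lsubmx x) * q (rsubmx x).
Proof.
rewrite (partial_mul Wx) // partial_lshift_lsub partial_lshift_rsub.
by rewrite mulr0 addr0.
Qed.

Lemma partial_rshift_mul a :
  partial (Rs a) (fun y => p (lsubmx y) * q (rsubmx y)) x =
  p (lsubmx x) * partial a q (rsubmx x).
Proof.
rewrite (partial_mul Wx) // partial_rshift_lsub partial_rshift_rsub.
by rewrite mul0r add0r.
Qed.

End Separated.

Definition local_grad (u : 'rV[R]_n -> R) (c : 'I_n) (y : 'rV[R]_n) : R :=
  \sum_l invmx (g y) c l * partial l u y.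

Lemma smooth_inverse_metric a b : smooth_on U (fun y => invmx (g y) a b).
Proof. by apply: smooth_invmx => // y Uy; exact/spd_unitmx/g_spd. Qed.

Lemma smooth_local_grad u c : smooth_on U u -> smooth_on U (local_grad u c).
Proof.
move=> su; apply: smooth_sum => // l _; apply: smooth_mul => //.
  exact: smooth_inverse_metric.
exact: smooth_partial.
Qed.

Section Point.
Context (x : 'rV[R]_(n + m)) (Wx : W x).
Let y := lsubmx x.
Let z := rsubmx x.
Let Uy : U y := Wx.1.
Let Vz : V z := Wx.2.

Let f0 : f y != 0.
Proof. by rewrite gt_eqF // f_gt0. Qed.

Let gU : g y \in unitmx.
Proof. exact/spd_unitmx/g_spd. Qed.

Let hU : h z \in unitmx.
Proof. exact/spd_unitmx/h_spd. Qed.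

Let f2hU : f y ^+ 2 *: h z \in unitmx.
Proof. by rewrite unitmxZ // unitfE expf_neq0. Qed.

Lemma warped_inv : invmx (G x) =
  block_mx (invmx (g y)) 0 0 (f y ^- 2 *: invmx (h z)).
Proof.
rewrite /G invmx_block_diag -/y -/z ?invmxZ //.
by rewrite unitmxE det_ublock unitrM -!unitmxE gU.
Qed.

Let dGlll c a b : partial (L c) (fun y => G y (L a) (L b)) x =
  partial c (fun y => g y a b) y.
Proof.
under eq_fun do rewrite block_mxEul.
by rewrite (partial_lshift_lsub c (fun y => g y a b)).
Qed.

Let dGrll c a b : partial (Rs c) (fun y => G y (L a) (L b)) x = 0.
Proof.
under eq_fun do rewrite block_mxEul.
by rewrite (partial_rshift_lsub c (fun y => g y a b)).
Qed.

Let dGlr k a b : partial k (fun y => G y (L a) (Rs b)) x = 0.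
Proof. by under eq_fun do rewrite block_mxEur mxE; exact: partial_cst. Qed.

Let dGrl k a b : partial k (fun y => G y (Rs a) (L b)) x = 0.
Proof. by under eq_fun do rewrite block_mxEdl mxE; exact: partial_cst. Qed.

Let sf2 : smooth_on U (fun y => f y ^+ 2).
Proof. exact: smooth_mul. Qed.

Let dGlrr c a b : partial (L c) (fun y => G y (Rs a) (Rs b)) x =
  2 * f y * partial c f y * h z a b.
Proof.
under eq_fun do rewrite block_mxEdr mxE.
rewrite (partial_lshift_mul sf2 (h_smooth a b)) //.
by rewrite (partial_mul Uy) // -/z; ring.
Qed.

Let dGrrr c a b : partial (Rs c) (fun y => G y (Rs a) (Rs b)) x =
  f y ^+ 2 * partial c (fun z => h z a b) z.
Proof.
under eq_fun do rewrite block_mxEdr mxE.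
by rewrite (partial_rshift_mul sf2 (h_smooth a b)).
Qed.

Let dG := (dGlll, dGrll, dGlr, dGrl, dGlrr, dGrrr).

Lemma fibre_metric_mulVmx a b : \sum_l invmx (h z) a l * h z b l = (a == b)%:R.
Proof.
have [th _] := h_spd Vz.
transitivity ((invmx (h z) *m h z) a b).
  rewrite mxE; apply: eq_bigr => l _; congr (_ * _).
  by rewrite -[in LHS]th mxE.
by rewrite mulVmx // mxE.
Qed.

(** In the suffixes, [l] stands for an index of the base (left block) and [r]
    for one of the fibre (right block), the upper index coming first. *)
Lemma christoffel_lll c a b :
  christoffel G (L c) (L a) (L b) x = christoffel g c a b y.
Proof.
rewrite /christoffel warped_inv big_split_ord /= [X in _ + X]big1 ?addr0.
  congr (_ * _); apply: eq_bigr => l _.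
  by rewrite block_mxEul dGlll dGlll dGlll.
by move=> l _; rewrite block_mxEur mxE mul0r.
Qed.

Lemma christoffel_rrr c a b :
  christoffel G (Rs c) (Rs a) (Rs b) x = christoffel h c a b z.
Proof.
rewrite /christoffel warped_inv big_split_ord /= [X in X + _]big1 ?add0r.
  congr (_ * _); apply: eq_bigr => l _; rewrite block_mxEdr mxE !dG.
  by rewrite -!mulrDr -mulrBr mulrACA mulVf ?mul1r // expf_neq0.
by move=> l _; rewrite block_mxEdl mxE mul0r.
Qed.

Lemma christoffel_llr c a b : christoffel G (L c) (L a) (Rs b) x = 0.
Proof.
rewrite /christoffel warped_inv big_split_ord /= !big1 ?addr0 ?mulr0 // => l _.
  by rewrite block_mxEur mxE mul0r.
by rewrite !dG addr0 subr0 mulr0.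
Qed.

Lemma christoffel_lrl c a b : christoffel G (L c) (Rs a) (L b) x = 0.
Proof.
rewrite /christoffel warped_inv big_split_ord /= !big1 ?addr0 ?mulr0 // => l _.
  by rewrite block_mxEur mxE mul0r.
by rewrite !dG addr0 subr0 mulr0.
Qed.

Lemma christoffel_lrr c a b :
  christoffel G (L c) (Rs a) (Rs b) x = - (f y * local_grad f c y) * h z a b.
Proof.
rewrite /christoffel warped_inv big_split_ord /= [X in _ + X]big1 ?addr0.
  rewrite /local_grad [f y * _]mulr_sumr -sumrN mulr_suml mulr_sumr.
  by apply: eq_bigr => l _; rewrite block_mxEul !dG; field.
by move=> l _; rewrite block_mxEur mxE mul0r.
Qed.

Lemma christoffel_rlr c a b :
  christoffel G (Rs c) (L a) (Rs b) x = partial a f y / f y * (c == b)%:R.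
Proof.
rewrite /christoffel warped_inv big_split_ord /= [X in X + _]big1 ?add0r.
  rewrite -fibre_metric_mulVmx !mulr_sumr; apply: eq_bigr => l _.
  by rewrite block_mxEdr mxE !dG; field.
by move=> l _; rewrite block_mxEdl mxE mul0r.
Qed.

Lemma christoffel_rrl c a b :
  christoffel G (Rs c) (Rs b) (L a) x = partial a f y / f y * (c == b)%:R.
Proof.
rewrite /christoffel warped_inv big_split_ord /= [X in X + _]big1 ?add0r.
  rewrite -fibre_metric_mulVmx !mulr_sumr; apply: eq_bigr => l _.
  by rewrite block_mxEdr mxE !dG; field.
by move=> l _; rewrite block_mxEdl mxE mul0r.
Qed.

End Point.

(** The Laplacian is written as the divergence of the gradient, the form in
    which it appears in the trace defining the Ricci tensor. *)
Definition local_laplacian (u : 'rV[R]_n -> R) (y : 'rV[R]_n) : R :=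
  \sum_c partial c (local_grad u c) y
  + \sum_c \sum_d christoffel g c c d y * local_grad u d y.

Definition local_grad_inner (u v : 'rV[R]_n -> R) (y : 'rV[R]_n) : R :=
  \sum_c local_grad u c y * partial c v y.

Section Curvature.
Context (x : 'rV[R]_(n + m)) (Wx : W x).
Let y := lsubmx x.
Let z := rsubmx x.
Let Uy : U y := Wx.1.
Let f0 : f y != 0.
Proof. by rewrite gt_eqF // f_gt0. Qed.

Lemma riemann_mixed c a b :
  riemann_curvature G (L c) (Rs b) (L c) (Rs a) x =
  - (partial c (fun y => f y * local_grad f c y) y
     + \sum_d christoffel g c c d y * (f y * local_grad f d y)
     - local_grad f c y * partial c f y) * h z a b.
Proof.
have sfg : smooth_on U (fun y => f y * local_grad f c y).
  by apply: smooth_mul => //; exact: smooth_local_grad.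
rewrite /riemann_curvature.
rewrite (@eq_partial _ _ W warped_open _
    (fun x => - (f (lsubmx x) * local_grad f c (lsubmx x))
              * h (rsubmx x) a b)) //; last first.
  by move=> x' Wx'; rewrite christoffel_lrr.
rewrite (partial_lshift_mul (smooth_opp oU sfg) (h_smooth a b)) // -/y -/z.
rewrite (partial_opp Uy) //.
rewrite (@eq_partial _ _ W warped_open _ (fun=> 0)) //; last first.
  by move=> x' Wx'; rewrite christoffel_llr.
rewrite partial_cst subr0 big_split_ord /=.
under eq_bigr => d _.
  rewrite christoffel_lll // christoffel_lrr // christoffel_lrl // mul0r subr0.
  rewrite mulrA mulrN -/y -/z.
over.
rewrite -mulr_suml sumrN.
rewrite (bigD1 b) //= [X in _ + (_ + (_ + X))]big1 ?addr0.
  rewrite christoffel_llr // christoffel_lrr // christoffel_rlr // eqxx mulr1.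
  by rewrite -/y -/z; field.
move=> d db; rewrite christoffel_llr // christoffel_rlr // (negPf db).
by rewrite mul0r mulr0 mulr0 subr0.
Qed.

(** The fibre directions contribute the curvature of the fibre, corrected by
    the products of Christoffel symbols whose summed index is in the base. *)
Lemma riemann_fibre c a b :
  riemann_curvature G (Rs c) (Rs b) (Rs c) (Rs a) x =
  riemann_curvature h c b c a z
  - local_grad_inner f f y * (h z a b - (c == a)%:R * h z c b).
Proof.
have dC k i j l : partial (Rs l) (christoffel G (Rs k) (Rs i) (Rs j)) x =
    partial l (christoffel h k i j) z.
  transitivity (partial (Rs l) (fun x => christoffel h k i j (rsubmx x)) x).
    apply: (eq_partial warped_open); last exact: Wx.
    by move=> x' Wx'; rewrite christoffel_rrr.
  exact: partial_rshift_rsub.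
rewrite /riemann_curvature !dC big_split_ord /=.
rewrite [X in _ + X]addrC addrA; congr (_ + _ + _).
  by apply: eq_bigr => d _; rewrite !christoffel_rrr.
rewrite /local_grad_inner -mulNr -sumrN mulr_suml; apply: eq_bigr => d _.
rewrite !christoffel_rrl // !christoffel_lrr // eqxx mulr1 -/y -/z.
by field.
Qed.

(** In the trace, the [n] base directions ([riemann_mixed]) give
    [f Delta f] and the [m] fibre directions ([riemann_fibre]) give
    [(m - 1) |df|^2], one of them being killed by the antisymmetry of the
    curvature. *)
Lemma ricci_fibre a b :
  local_ricci G x (Rs a) (Rs b) =
  local_ricci h z a b
  - (f y * local_laplacian f y + (m%:R - 1) * local_grad_inner f f y) * h z a b.
Proof.
rewrite !mxE big_split_ord /=.
under eq_bigr do rewrite riemann_mixed.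
under [X in _ + X]eq_bigr do rewrite riemann_fibre.
rewrite -mulr_suml sumrN [X in _ + X]sumrB addrCA; congr (_ + _).
have -> : \sum_(c < n) (partial c (fun y => f y * local_grad f c y) y
     + \sum_d christoffel g c c d y * (f y * local_grad f d y)
     - local_grad f c y * partial c f y) = f y * local_laplacian f y.
  rewrite /local_laplacian mulrDr !mulr_sumr -big_split.
  apply: eq_bigr => c _ /=.
  rewrite (partial_mul Uy) //; last exact: smooth_local_grad.
  under eq_bigr do rewrite mulrCA.
  rewrite -mulr_sumr; ring.
have -> : \sum_(i < m)
    local_grad_inner f f y * (h z a b - (i == a)%:R * h z i b) =
    local_grad_inner f f y * ((m%:R - 1) * h z a b).
  rewrite -mulr_sumr big_split /= sumr_const card_ord (bigD1 a) //= big1 ?addr0.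
    by rewrite eqxx mul1r mulrBl mul1r mulr_natl.
  by move=> j /negPf ->; rewrite mul0r oppr0.
by ring.
Qed.

Lemma hessian_fibre (u : 'rV[R]_n -> R) a b :
  local_hessian G (fun x => u (lsubmx x)) x (Rs a) (Rs b) =
  f y * local_grad_inner f u y * h z a b.
Proof.
rewrite mxE (_ : partial (Rs b) _ = fun=> 0); last first.
  by apply/funext => x'; exact: partial_rshift_lsub.
rewrite partial_cst sub0r big_split_ord /= [X in _ + X]big1 ?addr0; last first.
  by move=> c _; rewrite partial_rshift_lsub mulr0.
rewrite /local_grad_inner mulr_sumr mulr_suml -sumrN; apply: eq_bigr => c _.
by rewrite christoffel_lrr // partial_lshift_lsub -/y -/z; ring.
Qed.

End Curvature.

(** The first order coefficients of the operator
    [w |-> Delta w - <dw, dv> + (k / u) <dw, du>], once the divergence in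
    [local_laplacian] is expanded. *)
Definition drift (u v : 'rV[R]_n -> R) (k : R) (d : 'I_n) (y : 'rV[R]_n) : R :=
  \sum_c (partial c (fun y => invmx (g y) c d) y
    + (\sum_e christoffel g e e c y - partial c v y
       + k * (u y)^-1 * partial c u y) * invmx (g y) c d).

Lemma smooth_christoffel k i j : smooth_on U (christoffel g k i j).
Proof.
apply: smooth_mul => //; first exact: smooth_cst.
apply: smooth_sum => // l _; apply: smooth_mul => //.
  exact: smooth_inverse_metric.
apply: smooth_add => //; last first.
  by apply: smooth_opp => //; exact: smooth_partial.
by apply: smooth_add => //; exact: smooth_partial.
Qed.

Lemma smooth_drift v k d : smooth_on U v -> smooth_on U (drift f v k d).
Proof.
move=> sv; apply: smooth_sum => // c _; apply: smooth_add => //.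
  by apply: smooth_partial; exact: smooth_inverse_metric.
apply: smooth_mul => //; last exact: smooth_inverse_metric.
apply: smooth_add => //; last first.
  apply: smooth_mul => //; last exact: smooth_partial.
  apply: smooth_mul => //; first exact: smooth_cst.
  by apply: smooth_inv => // t Ut; rewrite gt_eqF ?f_gt0.
apply: smooth_add => //.
  by apply: smooth_sum => // e _; exact: smooth_christoffel.
by apply: smooth_opp => //; exact: smooth_partial.
Qed.

(** The quadratic term [|df|^2] is linear in the unknown once one of its two
    factors is frozen in the coefficients; this turns the nonlinear equation of
    [f] into one to which the maximum principle applies. *)
Lemma elliptic_drift v k y : U y -> smooth_on U v ->
  elliptic (fun y => invmx (g y)) (drift f v k) f y =
  local_laplacian f y - local_grad_inner f v y
  + k * (f y)^-1 * local_grad_inner f f y.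
Proof.
move=> Uy sv.
pose X (c : 'I_n) := \sum_e christoffel g e e c y - partial c v y
  + k * (f y)^-1 * partial c f y.
transitivity (\sum_c (partial c (local_grad f c) y + X c * local_grad f c y)).
  rewrite /elliptic [X in _ + X](_ : _ = \sum_c \sum_d
     (partial c (fun y => invmx (g y) c d) y + X c * invmx (g y) c d)
     * partial d f y).
    rewrite -big_split; apply: eq_bigr => c _ /=.
    rewrite /local_grad (partial_sum oU Uy); last first.
      move=> d; apply: smooth_mul => //; last exact: smooth_partial.
      exact: smooth_inverse_metric.
    rewrite mulr_sumr -!big_split; apply: eq_bigr => d _ /=.
    rewrite (partial_mul Uy); [by ring| |exact: smooth_partial].
    exact: smooth_inverse_metric.
  rewrite exchange_big; apply: eq_bigr => d _ /=.
  by rewrite /drift mulr_suml.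
rewrite /local_laplacian /local_grad_inner.
have -> : \sum_c \sum_d christoffel g c c d y * local_grad f d y =
    \sum_c \sum_e christoffel g e e c y * local_grad f c y.
  exact: exchange_big.
rewrite mulr_sumr -sumrN -!big_split; apply: eq_bigr => c _ /=.
by rewrite /X -mulr_suml; ring.
Qed.

End WarpedCoordinates.

(** * The warping function on the base manifold *)

Section Manifolds.
Context (R : realType) (n : nat).

Lemma spd_diag_gt0 (A : 'M[R]_n) i : spd A -> 0 < A i i.
Proof.
move=> [_ pA]; have := pA (delta_mx 0 i); rewrite -rowE trmx_delta -colE !mxE.
apply; apply/eqP => /matrixP/(_ 0 i); rewrite !mxE !eqxx => /eqP.
by rewrite oner_eq0.
Qed.

Lemma metric_spd (M : riemannian R n) i x : cimg (mchart i) x ->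
  spd (metric (r := M) i x).
Proof.
by move=> Mx; split; [exact: Defs.metric_sym | exact: metric_posdef].
Qed.

Lemma local_exprK (M : manifold R n) (u : M -> R) i p : cdom (mchart i) p ->
  local_expr u i (cmap (mchart i) p) = u p.
Proof. by move=> ip; rewrite /local_expr cmapK. Qed.

Lemma near_chart (M : manifold R n) i p (P : set 'rV[R]_n) :
  cdom (mchart (m := M) i) p ->
  (\forall x \near cmap (mchart i) p, P x) ->
  \forall q \near p, cdom (mchart i) q /\ P (cmap (mchart i) q).
Proof.
move=> ip nP; near=> q; split; near: q.
  by apply: open_nbhs_nbhs; split=> //; exact: cdom_open.
exact: (cmap_continuous ip).
Unshelve. all: by end_near. Qed.

Lemma smooth_fun_continuous (M : manifold R n) (u : M -> R) :
  smooth_fun u -> continuous u.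
Proof.
move=> su p; have [i ip] := mchart_cover p.
have cu := smooth_continuous (su i) (cmap_img ip).
move=> A; rewrite -(local_exprK u ip) => /cu /(near_chart ip).
by apply: filterS => q [iq]; rewrite /preimage /= local_exprK.
Qed.

(** The set where [u] takes its maximum is closed by continuity and open by
    [strong_maximum], applied in each chart to an operator that may depend on
    the chart. *)
Lemma constant_of_max (M : manifold R n) (u : M -> R)
    (a : mindex M -> 'rV[R]_n -> 'M[R]_n)
    (b : mindex M -> 'I_n -> 'rV[R]_n -> R) :
  connected [set: M] -> smooth_fun u ->
  (forall i x, cimg (mchart i) x -> spd (a i x)) ->
  (forall i j k, smooth_on (cimg (mchart i)) (fun x => a i x j k)) ->
  (forall i j, smooth_on (cimg (mchart i)) (b i j)) ->
  (forall i x, cimg (mchart i) x ->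
    0 <= elliptic (a i) (b i) (local_expr u i) x) ->
  (exists x0, forall x, u x <= u x0) -> exists c, forall x, u x = c.
Proof.
move=> cM su aP sa sb u_sub [x0 umax]; exists (u x0).
suff ET : [set x | u x = u x0] = [set: M].
  by move=> x; have : [set: M] x by []; rewrite -ET.
apply: cM; first by exists x0.
  exists [set x | u x = u x0]; last by rewrite setTI.
  rewrite openE => p /= up; have [i ip] := mchart_cover p.
  have ue : local_expr u i (cmap (mchart i) p) = u x0 by rewrite local_exprK.
  have := strong_maximum (cimg_open (c := mchart i)) (aP i) (sa i) (sb i) (su i)
    (u_sub i) (fun x _ => umax _) (cmap_img ip) ue.
  by move=> /(near_chart ip); apply: filterS => q [iq]; rewrite local_exprK.
exists [set x | u x = u x0]; last by rewrite setTI.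
apply: (@closed_comp _ _ u [set t | t = u x0]); last exact: closed_eq.
by move=> x _; exact: smooth_fun_continuous.
Qed.

End Manifolds.

Section WarpedSoliton.
Context (R : realType) (n m : nat) (B : riemannian R n) (F : riemannian R m).
Context (f phi lambda : B -> R) (mu : R).
Context (f_smooth : smooth_fun f) (f_gt0 : forall x, 0 < f x).
Context (m_gt1 : (1 < m)%N).
Context (M_connected : connected [set: warped_product F f_smooth f_gt0]).
Context (phi_smooth : smooth_fun phi).
Context (soliton :
  gradient_ricci_almost_soliton (M := warped_product F f_smooth f_gt0)
    (phi \o fst) (lambda \o fst)).
Context (F_einstein : einstein F mu).

Section Chart.
Context (i : mindex B).
Let U := cimg (mchart i).
Let g := metric (r := B) i.
Let lf := local_expr f i.
Let lphi := local_expr phi i.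

Let gS a b : smooth_on U (fun x => g x a b).
Proof. exact: metric_smooth. Qed.

Let gP x : U x -> spd (g x).
Proof. exact: metric_spd. Qed.

Let lf0 x : U x -> 0 < lf x.
Proof. by move=> _; exact: f_gt0. Qed.

(** The fibre component of the soliton equation is a multiple of the metric of
    the fibre; a diagonal coefficient of that metric is positive and can be
    cancelled. *)
Lemma fibre_equation y : U y ->
  lf y * local_laplacian g lf y + (m%:R - 1) * local_grad_inner g lf lf y
  - lf y * local_grad_inner g lf lphi y =
  mu - local_expr lambda i y * lf y ^+ 2.
Proof.
move=> Uy; have [q _] := mspace_nonempty F; have [j jq] := mchart_cover q.
set z := cmap (mchart j) q; have Vz : cimg (mchart j) z by exact: cmap_img.
pose b : 'I_m := Ordinal (ltnW m_gt1).
pose x := row_mx y z.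
have Wx : cimg (mchart (m := warped_product F f_smooth f_gt0) (i, j)) x.
  by split; rewrite /x ?row_mxKl ?row_mxKr.
have [_ _ _ /(_ (i, j) x Wx)/matrixP/(_ (rshift n b) (rshift n b))] := soliton.
rewrite mxE.
have hS (a c : 'I_m) :
    smooth_on (cimg (mchart j)) (fun x => metric (r := F) j x a c).
  exact: metric_smooth.
have hP x' : cimg (mchart j) x' -> spd (metric (r := F) j x').
  exact: metric_spd.
have oU : open U := cimg_open (c := mchart i).
have oV := cimg_open (c := mchart j).
have := ricci_fibre oU oV gS hS (f_smooth i) gP hP lf0 Wx b b.
rewrite /ricci => ->.
have := hessian_fibre oU hS (f_smooth i) gP hP lf0 Wx lphi b b.
rewrite /hessian => ->.
have := F_einstein Vz; rewrite /ricci.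
rewrite /x row_mxKl row_mxKr => ->.
rewrite !mxE (unsplitK (inr b)) row_mxEr mxE /= row_mxKl row_mxKr.
have lE : local_expr (M := warped_product F f_smooth f_gt0) (lambda \o fst)
    (i, j) (row_mx y z) = local_expr lambda i y.
  by rewrite /local_expr /= row_mxKl.
rewrite lE -/lf -/g -/lphi; set k := metric j z b b => E.
have k0 : k != 0 by rewrite gt_eqF //; apply: spd_diag_gt0; exact: metric_spd.
apply: (mulIf k0); rewrite [RHS]mulrBl -mulrA -E; ring.
Qed.

Let a x := invmx (g x).
Let b := drift g lf lphi (m%:R - 1).

Lemma warping_equation y : U y ->
  elliptic a b lf y = (mu - local_expr lambda i y * lf y ^+ 2) / lf y.
Proof.
move=> Uy; have oU : open U := cimg_open (c := mchart i).
have := fibre_equation Uy; have f0 := lt0r_neq0 (lf0 Uy).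
have := elliptic_drift oU gS (f_smooth i) gP (m%:R - 1) Uy (phi_smooth i).
rewrite -/lf -/lphi -/b -/a => -> <-.
by field.
Qed.

Lemma warping_spd x : U x -> spd (a x).
Proof. by move=> Ux; apply/spd_invmx/gP. Qed.

Lemma warping_smooth k l : smooth_on U (fun x => a x k l).
Proof. exact: (smooth_inverse_metric (cimg_open (c := mchart i)) gS gP). Qed.

Lemma warping_drift_smooth k : smooth_on U (b k).
Proof.
exact: (smooth_drift (cimg_open (c := mchart i)) gS (f_smooth i) gP lf0 _ _
  (phi_smooth i)).
Qed.

End Chart.

Let E (i : mindex B) := elliptic (fun x => invmx (metric (r := B) i x))
  (drift (metric (r := B) i) (local_expr f i) (local_expr phi i) (m%:R - 1)).

Let EN i x : cimg (mchart i) x ->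
  E i (fun y => - local_expr f i y) x = - E i (local_expr f i) x.
Proof.
move=> Ux; rewrite (_ : (fun y => - local_expr f i y) =
    fun y => local_expr f i y + (- 2) * local_expr f i y).
  rewrite /E (ellipticD (cimg_open (c := mchart i)) _ _ _
    (f_smooth i) (f_smooth i) Ux) //.
  by ring.
by apply/funext => y; ring.
Qed.

Lemma base_connected : connected [set: B].
Proof.
have <- : (fst : warped_product F f_smooth f_gt0 -> B) @` setT = setT.
  apply/seteqP; split=> // p _; have [q _] := mspace_nonempty F.
  by exists (p, q).
apply: connected_continuous_connected => //.
apply: continuous_subspaceT => x; exact: cvg_fst.
Qed.

Lemma warping_constant_of_max :
  (exists x0, forall x, f x <= f x0) -> (forall x, lambda x <= mu / f x ^+ 2) ->
  exists c, forall x, f x = c.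
Proof.
move=> fmax lmu; apply: (constant_of_max base_connected f_smooth _ _ _ _ fmax).
- exact: warping_spd.
- exact: warping_smooth.
- exact: warping_drift_smooth.
- move=> i x Ux; rewrite warping_equation //.
  have f0 := f_gt0 (cinv (mchart i) x).
  apply: divr_ge0; last exact: ltW.
  by rewrite subr_ge0 -ler_pdivlMr ?exprn_gt0 //; exact: lmu.
Qed.

Lemma warping_constant_of_min :
  (exists x0, forall x, f x0 <= f x) -> (forall x, mu / f x ^+ 2 <= lambda x) ->
  exists c, forall x, f x = c.
Proof.
move=> [x0 fmin] lmu; suff [c fc] : exists c, forall x, - f x = c.
  by exists (- c) => x; rewrite -(fc x) opprK.
apply: (constant_of_max (u := fun x => - f x) base_connected).
- by move=> i; apply: smooth_opp; [exact: cimg_open|exact: f_smooth].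
- exact: warping_spd.
- exact: warping_smooth.
- exact: warping_drift_smooth.
- move=> i x Ux; have := EN Ux; rewrite /E => ->; rewrite warping_equation //.
  have f0 := f_gt0 (cinv (mchart i) x).
  rewrite -mulNr opprB; apply: divr_ge0; last exact: ltW.
  by rewrite subr_ge0 -ler_pdivrMr ?exprn_gt0 //; exact: lmu.
- by exists x0 => x; rewrite lerN2.
Qed.

Lemma mu_le_at_max p : (forall x, f x <= f p) -> mu <= lambda p * f p ^+ 2.
Proof.
move=> fmax; have [i ip] := mchart_cover p; have Up := cmap_img ip.
have : E i (local_expr f i) (cmap (mchart i) p) <= 0.
  apply: (elliptic_max (cimg_open (c := mchart i)) _ (@warping_spd i)
    (f_smooth i) Up).
  by near=> y; rewrite local_exprK //; exact: fmax.
rewrite /E warping_equation // !local_exprK // pmulr_lle0 ?invr_gt0 //.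
by rewrite subr_le0.
Unshelve. all: by end_near. Qed.

Lemma mu_ge_at_min q : (forall x, f q <= f x) -> lambda q * f q ^+ 2 <= mu.
Proof.
move=> fmin; have [i iq] := mchart_cover q; have Uq := cmap_img iq.
have : E i (fun y => - local_expr f i y) (cmap (mchart i) q) <= 0.
  apply: (elliptic_max (cimg_open (c := mchart i)) _ (@warping_spd i) _ Uq).
    exact: (smooth_opp (cimg_open (c := mchart i)) (f_smooth i)).
  by near=> y; rewrite lerN2 local_exprK //; exact: fmin.
rewrite EN // oppr_le0 /E warping_equation // !local_exprK //.
by rewrite pmulr_lge0 ?invr_gt0 // subr_ge0.
Unshelve. all: by end_near. Qed.

(** Every point is both a maximum and a minimum of a constant function. *)
Lemma lambda_of_constant c :
  (forall x, f x = c) -> forall x, lambda x = mu / c ^+ 2.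
Proof.
move=> fc p.
have fp x : f x <= f p by rewrite !fc.
have fp' x : f p <= f x by rewrite !fc.
have := mu_le_at_max fp; have := mu_ge_at_min fp'; rewrite fc => h1 h2.
have c0 : 0 < c by rewrite -(fc p).
have -> : mu = lambda p * c ^+ 2 by apply/eqP; rewrite eq_le h1 h2.
by rewrite mulfK // expf_neq0 // gt_eqF.
Qed.

(** If [f q < f p] and [lambda p < 0], then
    [mu <= lambda p f(p)^2 < lambda p f(q)^2 <= lambda q f(q)^2 <= mu]. So
    [lambda p] vanishes, hence [lambda q] and [mu] too, and the hypothesis
    [lambda <= mu / f^2] of [warping_constant_of_max] holds. *)
Lemma warping_constant_of_nonpos p q :
  (forall x, lambda x <= 0) ->
  (forall x, f x <= f p) -> (forall x, f q <= f x) ->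
  lambda p <= lambda q -> exists c, forall x, f x = c.
Proof.
move=> l0 fp fq lpq.
have mup := mu_le_at_max fp; have muq := mu_ge_at_min fq.
have [fpq|fpq] := leP (f p) (f q).
  exists (f p) => x; apply/eqP; rewrite eq_le fp /=.
  exact: le_trans fpq (fq x).
have f2 : f q ^+ 2 < f p ^+ 2 by rewrite ltr_pXn2r ?nnegrE ?ltW.
have fq2 : 0 < f q ^+ 2 by rewrite exprn_gt0.
have lp : lambda p = 0.
  apply/eqP; rewrite eq_le l0 /=; rewrite leNgt; apply/negP => lp.
  have h1 : lambda p * f p ^+ 2 < lambda p * f q ^+ 2 by rewrite ltr_nM2l.
  have h2 : lambda p * f q ^+ 2 <= lambda q * f q ^+ 2 by rewrite ler_pM2r.
  by have := le_lt_trans mup (lt_le_trans h1 (le_trans h2 muq)); rewrite ltxx.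
have lq : lambda q = 0 by apply/eqP; rewrite eq_le l0 -lp.
have mu0 : mu = 0.
  by apply/eqP; rewrite eq_le; move: mup muq; rewrite lp lq !mul0r => -> ->.
apply: warping_constant_of_max; first by exists p.
by move=> x; rewrite mu0 mul0r.
Qed.

End WarpedSoliton.

Theorem theorem2 (R : realType) (n m : nat) (B : riemannian R n)
    (F : riemannian R m) (f phi lambda : B -> R) (mu : R)
    (f_smooth : smooth_fun f) (f_gt0 : forall x, 0 < f x) :
  (1 < m)%N ->
  connected [set: warped_product F f_smooth f_gt0] ->
  smooth_fun phi -> smooth_fun lambda ->
  gradient_ricci_almost_soliton (M := warped_product F f_smooth f_gt0)
    (phi \o fst) (lambda \o fst) ->
  einstein F mu ->
  ((((exists x0, forall x, f x0 <= f x) /\ forall x, mu / f x ^+ 2 <= lambda x)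
    \/
    ((exists x0, forall x, f x <= f x0) /\ forall x, lambda x <= mu / f x ^+ 2))
   \/
   ((forall x, lambda x <= 0) /\
    exists p q, [/\ forall x, f x <= f p, forall x, f q <= f x &
                    lambda p <= lambda q])) ->
  (exists c, forall x, f x = c) /\ (exists c, forall x, lambda x = c).
Proof.
move=> m_gt1 cM phi_smooth _ soliton einF cond.
have [c fc] : exists c, forall x, f x = c.
  case: cond => [[[fmin lmu]|[fmax lmu]]|[l0 [p [q [fp fq lpq]]]]].
  - exact: (warping_constant_of_min m_gt1 cM phi_smooth soliton einF).
  - exact: (warping_constant_of_max m_gt1 cM phi_smooth soliton einF).
  - exact: (warping_constant_of_nonpos m_gt1 cM phi_smooth soliton einF
      l0 fp fq).
split; first by exists c.
exists (mu / c ^+ 2).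
exact: (lambda_of_constant m_gt1 phi_smooth soliton einF fc).
Qed.
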